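(* Let $G$ be a primitive group of permutations of an infinite set $\Omega$, with more than one permutation-end and no infinite subdegree. Then $G$ has a locally finite orbital digraph with connectivity one in which each lobe has at most one end.
   Context: Permutations act on the right. A transitive permutation group $G$ on $\Omega$ is primitive if the only $G$-invariant equivalence relations on $\Omega$ are the trivial and universal ones. The subdegrees of $G$ are the cardinalities of the orbits of the point stabilisers $G_\alpha$ on $\Omega$. A digraph $\Gamma=(V\Gamma,A\Gamma)$ has no loops and no multiple arcs; $A\Gamma$ is a set of ordered pairs of distinct vertices. Vertices $\alpha,\beta$ are adjacent if $(\alpha,\beta)$ or $(\beta,\alpha)$ lies in $A\Gamma$. All paths and connectedness are undirected (directions of arcs are ignored). A digraph is locally finite if every vertex is adjacent to at most finitely many vertices. For $\alpha,\beta\in\Omega$, the digraph $(\Omega,(\alpha,\beta)^G)$ with vertex set $\Omega$ and arc set the orbit $(\alpha,\beta)^G$ is an orbital digraph of $G$; it is non-diagonal if $\alpha\neq\beta$. A half-line is a one-way infinite cycle-free (undirected) path. Two half-lines are equivalent if there are infinitely many pairwise disjoint paths connecting a vertex of one to a vertex of the other; the equivalence classes are the ends. Finite digraphs have no ends. The connectivity of an infinite connected digraph $\Gamma$ is the smallest cardinality of a set $W\subseteq V\Gamma$ such that the induced digraph $\Gamma\setminus W$ is not connected. A lobe of $\Gamma$ is a connected subgraph that is maximal subject to having connectivity strictly greater than one (that is, a block in the usual sense: a maximal connected subgraph with at least two vertices and no cut vertex of its own). If $G$ is primitive on the infinite set $\Omega$ and has no infinite subdegree, all non-diagonal orbital digraphs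 of $G$ are connected and locally finite, and the identity map on $\Omega$ induces natural bijections between their sets of ends. The permutation-ends of $G$ are the ends of any non-diagonal orbital digraph of $G$, under these identifications; so $G$ has more than one permutation-end if and only if one (equivalently, every) non-diagonal orbital digraph of $G$ has more than one end. *)

(* Defs.v *)
From mathcomp Require Import all_boot.
From mathcomp Require Import boolp classical_sets functions cardinality.

Set Implicit Arguments.
Unset Strict Implicit.
Unset Printing Implicit Defensive.

Local Open Scope classical_set_scope.
Local Open Scope card_scope.

Section PermutationGroups.
Variable Omega : Type.
Implicit Types (G : set (Omega -> Omega)) (E : Omega -> Omega -> Prop).

(* The image of [a] under [g] is [g a]; since permutations act on the right,
   the product "g followed by h" is the function [h \o g]. *)
Definition permutation_group G : Prop :=
  [/\ forall g, G g -> bijective g,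
      G id,
      forall g h, G g -> G h -> G (h \o g)
    & forall g h, G g -> cancel g h -> G h].

Definition transitive_group G : Prop :=
  forall a b, exists2 g, G g & g a = b.

Definition invariant_rel G E : Prop :=
  forall g, G g -> forall a b, E a b <-> E (g a) (g b).

Definition primitive_group G : Prop :=
  [/\ permutation_group G,
      transitive_group G
    & forall E, RelationClasses.Equivalence E -> invariant_rel G E ->
        (forall a b, E a b <-> a = b) \/ (forall a b, E a b)].

Definition point_stabiliser G (a : Omega) : set (Omega -> Omega) :=
  [set g | G g /\ g a = a].

Definition orbit_of G (b : Omega) : set Omega := [set g b | g in G].

Definition no_infinite_subdegree G : Prop :=
  forall a b, finite_set (orbit_of (point_stabiliser G a) b).

End PermutationGroups.

(* Vertices are drawn from an ambient type, so that the digraph, its subgraphs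
   and its vertex-deleted subgraphs all have the same type. *)
Record digraph (T : Type) := Digraph {
  vertices : set T;
  arcs : set (T * T);
  arcs_vertices : forall a b, arcs (a, b) -> vertices a /\ vertices b;
  arcs_loopless : forall a, ~ arcs (a, a) }.

Section Digraphs.
Variable T : choiceType.
Implicit Types (D H K : digraph T) (W : set T).

Definition adjacent D (a b : T) : Prop := arcs D (a, b) \/ arcs D (b, a).

Definition locally_finite D : Prop :=
  forall a, vertices D a -> finite_set [set b | adjacent D a b].

(* [a :: p] is the sequence of vertices of an undirected path; [p = [::]] gives
   the path of length 0 at [a]. *)
Definition upath D (a : T) (p : seq T) : Prop :=
  [/\ vertices D a, path (fun x y => `[< adjacent D x y >]) a p
    & uniq (a :: p)].

Definition connected D : Prop :=
  forall a b, vertices D a -> vertices D b ->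
    exists2 p, upath D a p & last a p = b.

Definition subgraph H D : Prop :=
  vertices H `<=` vertices D /\ arcs H `<=` arcs D.

Definition delete_arcs D W : set (T * T) :=
  [set e | [/\ arcs D e, ~ W e.1 & ~ W e.2]].

Fact delete_arcs_vertices D W a b :
  delete_arcs D W (a, b) ->
  (vertices D `\` W) a /\ (vertices D `\` W) b.
Proof. by case=> /= Dab Wa Wb; have [Da Db] := arcs_vertices Dab. Qed.

Fact delete_arcs_loopless D W a : ~ delete_arcs D W (a, a).
Proof. by case=> Daa _ _; exact: arcs_loopless Daa. Qed.

(* The subgraph of [D] induced on [vertices D `\` W]. *)
Definition delete_vertices D W : digraph T :=
  Digraph (@delete_arcs_vertices D W) (@delete_arcs_loopless D W).

Definition separating D W : Prop :=
  W `<=` vertices D /\ ~ connected (delete_vertices D W).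

Definition has_connectivity D (n : nat) : Prop :=
  [/\ infinite_set (vertices D), connected D,
      exists2 W, separating D W & W #= `I_n
    & forall W, separating D W -> `I_n #<= W].

(* Meaningful for finite digraphs too, where there may be no separating set at
   all (a digraph with two adjacent vertices, for instance). *)
Definition connectivity_gt D (n : nat) : Prop :=
  forall W, separating D W -> ~ (W #<= `I_n).

(* The requirement of two vertices discards the one-vertex digraph, for which
   [connectivity_gt] holds vacuously. *)
Definition lobe_candidate H : Prop :=
  [/\ connected H,
      exists a b, [/\ vertices H a, vertices H b & a <> b]
    & connectivity_gt H 1].

Definition lobe D H : Prop :=
  [/\ subgraph H D, lobe_candidate H
    & forall K, subgraph K D -> lobe_candidate K -> subgraph H K ->
        subgraph K H].

Definition half_line D (r : nat -> T) : Prop :=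
  injective r /\ forall n, adjacent D (r n) (r n.+1).

Definition connecting_path D (r s : nat -> T) (p : seq T) : Prop :=
  exists a q, [/\ p = a :: q, upath D a q, range r a & range s (last a q)].

Definition half_line_equiv D (r s : nat -> T) : Prop :=
  exists P : set (seq T),
    [/\ infinite_set P,
        forall p, P p -> connecting_path D r s p
      & forall p q, P p -> P q -> p <> q -> forall x, x \in p -> x \notin q].

Definition ends D : set (set (nat -> T)) :=
  [set e | exists2 r, half_line D r
             & e = [set s | half_line D s /\ half_line_equiv D r s]].

Definition at_most_one_end D : Prop := is_subset1 (ends D).

Definition more_than_one_end D : Prop := ~ is_subset1 (ends D).

Definition orbital_digraph (G : set (T -> T)) D : Prop :=
  exists a b, [/\ a <> b, vertices D = setT
                & arcs D = [set (g a, g b) | g in G]].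

(* For the primitive groups without infinite subdegree considered here, the
   number of ends is the same for all non-diagonal orbital digraphs. *)
Definition more_than_one_permutation_end (G : set (T -> T)) : Prop :=
  exists2 D, orbital_digraph G D & more_than_one_end D.

End Digraphs.

(* Main.v *)
Require Import Defs.
From mathcomp Require Import all_boot.
From mathcomp Require Import finmap boolp classical_sets functions cardinality.
From mathcomp Require Import zify.

(** A tree-like structure on [Omega] is encoded by a ternary relation
    [sep z x y], to be read as: the point [z] lies strictly between [x] and [y].
    The record [separation] lists what is needed of it; above all, removing [z]
    splits the other points into branches, and only finitely many points lie
    between two given ones. Three facts about invariant separations of a
    primitive group [G] without infinite subdegrees give the theorem.

    From separations to digraphs. Given [a] and [b], the point [x] next to [a]
    on the way to [b] has nothing between itself and [a]. The orbital digraph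
    [D] of the pair [(a, x)] is connected by primitivity, and none of its arcs
    jumps over a point, so deleting [z] from [D] disconnects whatever [z]
    separates. As soon as something is separated, [D] has connectivity one.

    Bounded branching. The stabiliser of [a] and [b] fixes [x], so the outdegree
    of [D] is at most the subdegree of [b] at [a]. Every component of [D]
    without [z] contains an out-neighbour of [z]: it contains some neighbour of
    [z] because [D] is connected, and in- and out-neighbours occupy the same
    components because [D] has an odd cycle ([primitive_turn]), as a bipartition
    of [D] would be an invariant equivalence relation. Hence the number of
    branches at a point is bounded by a subdegree that does not depend on the
    separation ([gate_orbital]).

    From cuts to separations. Let [L] be an invariant family of vertex sets of
    [D], and suppose that some set of vertices with finite boundary splits a
    member of [L] into two infinite parts. Among these sets, take those with
    the smallest boundary, and among the latter those which cross the fewest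
    others. They are pairwise nested, by the submodularity of the boundary size
    ([optimal_cuts_nested], after Dunwoody and Kroen); they are connected, and
    only finitely many of them separate two given points
    ([finite_tight_cuts]). By primitivity they distinguish all points. So they
    define an invariant separation, in which [z] lies between [x] and [y] when
    no cut contains [x] and [y] but not [z].

    Now choose an invariant separation with the largest number of branches, and
    let [D] be its digraph. The given digraph with more than one end, with the
    whole vertex set as the only member of [L], provides a separation with two
    branches, so [D] has connectivity one. Suppose that a lobe [H] of [D] has
    more than one end. A path of [D] between vertices of [H] stays in [H], so
    finitely many vertices separate two half-lines of [H] within [D] as well;
    this gives a set with finite boundary which splits [H]. The separation
    obtained from the translates of [H] refines the components of [D] without
    [z], because optimal cuts are connected. It even subdivides each of these
    components: the largest optimal cut inside a component cannot be the whole
    component, because no component of [D] without [z] splits a translate of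
    [H]. This contradicts the maximality of the number of branches. *)

Set Implicit Arguments.
Unset Strict Implicit.
Unset Printing Implicit Defensive.

Local Open Scope classical_set_scope.
Local Open Scope card_scope.

(** * Cardinalities of finite sets *)

Lemma minimizer (U : Type) (P : U -> Prop) (f : U -> nat) :
  (exists x, P x) -> exists2 x, P x & forall y, P y -> f x <= f y.
Proof.
move=> [x0 Px0]; have ex : exists n, `[< exists2 x, P x & f x = n >].
  by exists (f x0); apply/asboolP; exists x0.
case: (ex_minnP ex) => n /asboolP[x Px <-] min; exists x => // y Py.
by apply: min; apply/asboolP; exists y.
Qed.

Lemma leq_mem_modular (U : Type) (A B C D : set U) x :
  (A x -> C x \/ D x) -> (B x -> C x \/ D x) -> (A x -> B x -> C x /\ D x) ->
  (x \in A) + (x \in B) <= (x \in C) + (x \in D).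
Proof.
by rewrite /in_mem /= /in_set; do ! case: asboolP => //; tauto.
Qed.

Section Card.
Variable T : choiceType.
Implicit Types A B C D Z : set T.

Definition ncard A : nat := #|` fset_set A|%fset.

Lemma ncardE A (s : seq T) : finite_set A -> uniq s -> A `<=` [set` s] ->
  ncard A = \sum_(x <- s) (x \in A).
Proof.
move=> fA us sub; rewrite (eq_bigr (fun x => if x \in A then 1 else 0)); last first.
  by move=> x _; case: (x \in A).
rewrite -big_mkcond sum1_count -size_filter; apply/perm_size/uniq_perm.
- exact: fset_uniq.
- exact: filter_uniq.
move=> x; rewrite in_fset_set // mem_filter; case: (boolP (x \in A)) => //=.
by rewrite inE => /sub /= ->.
Qed.

(** The set [Z] turns the conclusion into a strict inequality when it is a
    singleton; the submodular inequality for boundaries has [Z] empty. *)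
Lemma leq_ncard_modular A B Z C D :
  finite_set A -> finite_set B -> finite_set Z -> finite_set C -> finite_set D ->
  (forall x, (x \in A) + (x \in B) + (x \in Z) <= (x \in C) + (x \in D)) ->
  ncard A + ncard B + ncard Z <= ncard C + ncard D.
Proof.
move=> fA fB fZ fC fD le.
have /finite_seqP[s Es] : finite_set (C `|` D) by rewrite finite_setU.
have subs X : (forall x, x \in X -> (x \in C) || (x \in D)) ->
    X `<=` [set` undup s].
  move=> XCD x Xx; rewrite /= mem_undup.
  have: ([set` s] x) by rewrite -Es; move: (XCD x); rewrite !inE => /(_ Xx)/orP[];
    rewrite inE; [left|right].
  by [].
have aux (b c d e f : bool) : b + c + d <= e + f ->
    [/\ b -> e || f, c -> e || f & d -> e || f].
  by case: b c d e f => [] [] [] [] [].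
have subABZ x := aux _ _ _ _ _ (le x).
have us := undup_uniq s.
rewrite (ncardE fA us); last by apply: subs => x; case: (subABZ x).
rewrite (ncardE fB us); last by apply: subs => x; case: (subABZ x).
rewrite (ncardE fZ us); last by apply: subs => x; case: (subABZ x).
rewrite (ncardE fC us); last by apply: subs => x ->.
rewrite (ncardE fD us); last by apply: subs => x ->; rewrite orbT.
by rewrite -!big_split /= leq_sum.
Qed.

Lemma ncard_set0 : ncard set0 = 0.
Proof. by rewrite /ncard fset_set0. Qed.

Lemma ncard_set1 (x : T) : ncard [set x] = 1.
Proof. by rewrite /ncard fset_set1 cardfs1. Qed.

Lemma subset_leq_ncard A B : finite_set B -> A `<=` B -> ncard A <= ncard B.
Proof.
move=> fB AB; have fA := sub_finite_set AB fB.
have f0 := @finite_set0 T.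
have := leq_ncard_modular fA f0 f0 fB f0.
rewrite ncard_set0 !addn0 => H; apply: H => x; rewrite !in_set0 !addn0.
by case: (boolP (x \in A)) => //; rewrite inE => /AB /mem_set ->.
Qed.

Lemma subset_ncard_eq A B : finite_set B -> A `<=` B -> ncard B <= ncard A -> A = B.
Proof.
move=> fB AB le; apply/seteqP; split=> // x Bx; apply: contrapT => nAx.
have fA := sub_finite_set AB fB.
have f0 := @finite_set0 T.
have := leq_ncard_modular fA (finite_set1 x) f0 fB f0.
rewrite ncard_set0 ncard_set1 !addn0 addn1 ltnNge le => H.
suff: false by []; apply: H => y; rewrite !in_set0 !addn0.
have [yA|_] := boolP (y \in A); last first.
  by have [|//] := boolP (y \in [set x]); rewrite inE => ->; rewrite (mem_set Bx).
have /negPf-> : y \notin [set x].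
  by apply/negP; move: yA; rewrite !inE => yA yx; rewrite yx in yA.
by move: yA; rewrite inE => /AB /mem_set ->.
Qed.

End Card.

Lemma ncard_preimage (T : choiceType) (f h : T -> T) (A : set T) :
  cancel f h -> cancel h f -> ncard (f @^-1` A) = ncard A.
Proof.
move=> fK hK; have -> : f @^-1` A = h @` A.
  apply/seteqP; split=> [x Afx|_ [x Ax <-]]; last by rewrite /preimage /= hK.
  by exists (f x) => //; rewrite fK.
have hinj : injective h by exact: can_inj hK.
have [fA|nfA] := pselect (finite_set A).
  apply/(fcard_eq (finite_image h fA) fA).
  exact: (inj_card_eq (A := A) (f := h)) (in2W hinj).
(* The default value of [fset_set] at infinite sets is used on both sides. *)
rewrite /ncard /fset_set; case: pselect => [fhA|_]; last by case: pselect.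
suff: finite_set A by [].
have -> : A = h @^-1` (h @` A).
  by apply/seteqP; split=> [x Ax|x [y Ay /hinj <-]] //; exists x.
by apply: finite_preimage fhA; exact: in2W hinj.
Qed.

(** * Reachability inside a set of vertices *)

Section Reach.
Variable T : Type.
Implicit Types (R : T -> T -> Prop) (X Y : set T).

Inductive reach R X (x : T) : T -> Prop :=
| reach_refl : X x -> reach R X x x
| reach_step y z : reach R X x y -> R y z -> X z -> reach R X x z.

Definition symmetric_rel R := forall x y, R x y -> R y x.

Definition connected_in R X := forall x y, X x -> X y -> reach R X x y.

Lemma reach_source R X x y : reach R X x y -> X x.
Proof. by elim. Qed.

Lemma reach_target R X x y : reach R X x y -> X y.
Proof. by case. Qed.

Lemma reach_trans R X x y z : reach R X x y -> reach R X y z -> reach R X x z.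
Proof. by move=> xy; elim=> [//|u v _ xu uv Xv]; apply: reach_step xu uv Xv. Qed.

Lemma reach_edge R X x y : X x -> X y -> R x y -> reach R X x y.
Proof. by move=> Xx Xy xy; apply: reach_step xy Xy; apply: reach_refl. Qed.

Lemma reach_sym R X x y : symmetric_rel R -> reach R X x y -> reach R X y x.
Proof.
move=> Rsym; elim=> [|u v xu ux uv Xv]; first exact: reach_refl.
apply: reach_trans ux; apply: reach_edge => //; last exact: Rsym.
exact: reach_target xu.
Qed.

Lemma reach_sub R R' X Y x y : X `<=` Y ->
  (forall u v, X u -> X v -> R u v -> R' u v) ->
  reach R X x y -> reach R' Y x y.
Proof.
move=> XY RR'; elim=> [/XY|u v xu xu' uv Xv]; first exact: reach_refl.
apply: reach_step xu' _ (XY _ Xv); apply: RR' => //; exact: reach_target xu.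
Qed.

Lemma reach_setS R X Y x y : X `<=` Y -> reach R X x y -> reach R Y x y.
Proof. by move=> XY; apply: reach_sub. Qed.

Lemma reach_map R X Y (g : T -> T) x y :
  (forall u, X u -> Y (g u)) -> (forall u v, R u v -> R (g u) (g v)) ->
  reach R X x y -> reach R Y (g x) (g y).
Proof.
move=> XY gR; elim=> [/XY|u v _ xu uv /XY Yv]; first exact: reach_refl.
by apply: reach_step xu _ Yv; apply: gR.
Qed.

Lemma reach_exit R X (C : set T) x y : reach R X x y -> C x -> ~ C y ->
  exists u v, [/\ reach R X x u, C u, X v, ~ C v & R u v].
Proof.
move=> xy Cx; elim: xy => [//|u v xu IH uv Xv nCv].
by have [Cu|/IH//] := pselect (C u); exists u, v.
Qed.

(** All sets containing one end of a walk and missing the other have an arc of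
    the walk in their boundary, so finitely many arcs serve for all of them. *)
Lemma reach_crossings R X x y : reach R X x y ->
  exists P : set (T * T), [/\ finite_set P,
    forall p, P p -> R p.1 p.2
  & forall C : set T, C x -> ~ C y -> exists p, [/\ P p, C p.1 & ~ C p.2]].
Proof.
elim=> [_|u v _ [P [fP PR PC]] uv Xv].
  by exists set0; split=> // C Cx /(_ Cx).
exists (P `|` [set (u, v)]); split.
- by rewrite finite_setU; split=> //; exact: finite_set1.
- by move=> p [/PR//|->].
move=> C Cx nCv; have [Cu|nCu] := pselect (C u).
  by exists (u, v); split=> //; right.
by have [p [Pp Cp nCp]] := PC C Cx nCu; exists p; split=> //; left.
Qed.

End Reach.

(** * Finitely many tight cuts separate two points *)

Section TightCuts.
Variable T : choiceType.
Implicit Types (R : T -> T -> Prop) (X Y : set T).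

(** Each edge of a symmetric relation that leaves [X] is counted in both
    directions, which makes the boundary of the complement the same set. *)
Definition boundary R X : set (T * T) :=
  [set p | R p.1 p.2 /\ (X p.1 <-> ~ X p.2)].

Definition delete_edge R (a b : T) : T -> T -> Prop :=
  fun u v => [/\ R u v, (u, v) <> (a, b) & (u, v) <> (b, a)].

Lemma tight_cut_component R x y X : ~ reach R setT x y -> X x -> ~ X y ->
  connected_in R X -> connected_in R (~` X) -> X = [set z | reach R setT x z].
Proof.
move=> nxy Xx nXy conX conX'; apply/seteqP; split=> z /=.
  by move=> Xz; apply: reach_setS (conX _ _ Xx Xz).
move=> xz; apply: contrapT => nXz; apply: nxy; apply: reach_trans xz _.
by apply: reach_setS (conX' _ _ nXz nXy).
Qed.

(** By induction on the size of the boundary. If [x] and [y] are connected, fix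
    a path between them: each such cut has one of its finitely many edges in
    its boundary, and deleting this edge makes the boundary smaller while
    both sides remain connected. Otherwise the cut is the component of [x]. *)
Lemma finite_tight_cuts R x y k : symmetric_rel R ->
  finite_set [set X | [/\ X x, ~ X y, finite_set (boundary R X),
    ncard (boundary R X) <= k & connected_in R X /\ connected_in R (~` X)]].
Proof.
elim: k R x y => [|k IH] R x y Rsym;
  (have [Rxy|nRxy] := pselect (reach R setT x y); last first;
   first by apply: sub_finite_set (finite_set1 [set z | reach R setT x z])
     => X [Xx nXy _ _ [conX conX']]; exact: (tight_cut_component nRxy)).
  apply: sub_finite_set (@finite_set0 _).
  move=> X [Xx nXy fX cX _]; have [u [v [_ Xu _ nXv uv]]] := reach_exit Rxy Xx nXy.
  have : ncard [set (u, v)] <= ncard (boundary R X).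
    by apply: subset_leq_ncard => // _ ->; split=> //; split.
  by rewrite ncard_set1; case: (ncard _) cX.
have [P [fP PR Pcross]] := reach_crossings Rxy.
have del_sym a b : symmetric_rel (delete_edge R a b).
  move=> u v [/Rsym uv n1 n2].
  by split=> // -[E1 E2]; [apply: n2|apply: n1]; rewrite E1 E2.
pose F p := [set X | [/\ X p.1, ~ X p.2,
    finite_set (boundary (delete_edge R p.1 p.2) X),
    ncard (boundary (delete_edge R p.1 p.2) X) <= k
  & connected_in (delete_edge R p.1 p.2) X
    /\ connected_in (delete_edge R p.1 p.2) (~` X)]].
apply: (@sub_finite_set _ _ (\bigcup_(p in P) F p)); last first.
  by apply: bigcup_finite => // p _; apply: IH.
move=> X [Xx nXy fX cX [conX conX']].
have [[u v] [/= Puv Xu nXv]] := Pcross X Xx nXy.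
have sub : boundary (delete_edge R u v) X `<=` boundary R X `\ (u, v).
  by move=> [a b] [/= [ab n _] H]; split=> //; split.
exists (u, v) => //; split=> //=.
- by apply: sub_finite_set fX => p /sub[].
- apply: leq_trans (subset_leq_ncard _ sub) _; first exact: finite_setD.
  rewrite -ltnS; apply: leq_trans cX.
  have fD : finite_set (boundary R X `\ (u, v)) by exact: finite_setD.
  rewrite ltnNge; apply/negP => /(subset_ncard_eq fX (@subDsetl _ _ _)) E.
  have : boundary R X (u, v) by split; [exact: PR Puv|split].
  by rewrite -E => -[_]; apply.
split=> a b Xa Xb; [have := conX _ _ Xa Xb|have := conX' _ _ Xa Xb];
  apply: reach_sub => // c d Xc Xd cd; split=> // -[E1 E2].
- by apply: nXv; rewrite -E2.
- by apply: nXv; rewrite -E1.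
- by apply: Xc; rewrite E1.
- by apply: Xd; rewrite E2.
Qed.

End TightCuts.

(** * Nested families of optimal cuts *)

Section NestedCuts.
Variable T : choiceType.
Implicit Types (R : T -> T -> Prop) (L : set (set T)) (X Y Z W : set T).

(** The members of [L] play the role of the ends in the usual notion of a cut:
    a cut has to divide one of them into two infinite parts. *)
Definition splits L X : Prop :=
  exists2 B, L B & infinite_set (B `&` X) /\ infinite_set (B `&` ~` X).

Definition splitting_cut R L X : Prop := finite_set (boundary R X) /\ splits L X.

Definition minimal_cut R L X : Prop := splitting_cut R L X /\
  forall Y, splitting_cut R L Y -> ncard (boundary R X) <= ncard (boundary R Y).

Definition nested X Y : Prop :=
  [\/ X `<=` Y, X `<=` ~` Y, ~` X `<=` Y | ~` X `<=` ~` Y].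

Definition crossing R L X : set (set T) :=
  [set Y | minimal_cut R L Y /\ ~ nested X Y].

Definition optimal_cut R L X : Prop := minimal_cut R L X /\
  forall Y, minimal_cut R L Y -> ncard (crossing R L X) <= ncard (crossing R L Y).

Lemma splitsC L X : splits L X -> splits L (~` X).
Proof. by move=> [B LB [iX iX']]; exists B; rewrite ?setCK. Qed.

Lemma boundaryC R X : boundary R (~` X) = boundary R X.
Proof.
apply/seteqP; split=> -[u v] /= [uv H]; split=> //; move: H; rewrite /setC /=;
  case: (pselect (X u)); case: (pselect (X v)); tauto.
Qed.

Lemma splitting_cutC R L X : splitting_cut R L X -> splitting_cut R L (~` X).
Proof. by move=> [fX sX]; split; rewrite ?boundaryC //; apply: splitsC. Qed.

Lemma minimal_cutC R L X : minimal_cut R L X -> minimal_cut R L (~` X).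
Proof. by move=> [cX mX]; split; [apply: splitting_cutC|rewrite boundaryC]. Qed.

Lemma nestedCl X Y : nested (~` X) Y <-> nested X Y.
Proof.
by rewrite /nested setCK; split=> -[]; try (by constructor 1); try (by constructor 2);
  try (by constructor 3); by constructor 4.
Qed.

Lemma nested_sym X Y : nested X Y -> nested Y X.
Proof.
move=> [] XY; [constructor 4|constructor 2|constructor 3|constructor 1] => x.
- by move=> nYx /XY.
- by move=> Yx Xx; apply: (XY x).
- by move=> nYx; apply: contrapT => /XY.
- by move=> Yx; apply: contrapT => /XY; apply.
Qed.

Lemma nestedCr X Y : nested X (~` Y) <-> nested X Y.
Proof.
by split=> /nested_sym; [move/nestedCl|move=> ?; apply: nested_sym; apply/nestedCl];
 [move/nested_sym|].
Qed.

Lemma crossingC R L X : crossing R L (~` X) = crossing R L X.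
Proof.
by apply/seteqP; split=> Y [mY nXY]; split=> //; move/nestedCl.
Qed.

Lemma optimal_cutC R L X : optimal_cut R L X -> optimal_cut R L (~` X).
Proof. by move=> [cX mX]; split; [apply: minimal_cutC|rewrite crossingC]. Qed.

Lemma boundaryI R X Y : boundary R (X `&` Y) `<=` boundary R X `|` boundary R Y.
Proof.
move=> [u v] [/= uv H]; rewrite /boundary /= in H *.
case: (pselect (X u)); case: (pselect (X v)); case: (pselect (Y u));
case: (pselect (Y v)); tauto.
Qed.

Lemma boundary_finiteI R X Y : finite_set (boundary R X) ->
  finite_set (boundary R Y) -> finite_set (boundary R (X `&` Y)).
Proof.
by move=> fX fY; apply: sub_finite_set (@boundaryI R X Y) _; rewrite finite_setU.
Qed.

Lemma boundary_finiteU R X Y : finite_set (boundary R X) ->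
  finite_set (boundary R Y) -> finite_set (boundary R (X `|` Y)).
Proof.
by move=> fX fY; rewrite -boundaryC setCU; apply: boundary_finiteI; rewrite boundaryC.
Qed.

Lemma boundary_submodular R X Y : finite_set (boundary R X) ->
  finite_set (boundary R Y) ->
  ncard (boundary R (X `&` Y)) + ncard (boundary R (X `|` Y)) <=
  ncard (boundary R X) + ncard (boundary R Y).
Proof.
move=> fX fY; have f0 := @finite_set0 (T * T)%type.
have := leq_ncard_modular (boundary_finiteI fX fY) (boundary_finiteU fX fY) f0 fX fY.
rewrite ncard_set0 addn0 => H; apply: H => -[u v]; rewrite in_set0 addn0.
by apply: leq_mem_modular; rewrite /boundary /=; case: (pselect (X u));
  case: (pselect (X v)); case: (pselect (Y u)); case: (pselect (Y v)); tauto.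
Qed.

(** One of the two pairs of opposite corners of [X] and [Y] can be used for
    uncrossing. If both cuts split the same member of [L], at least two opposite
    quarters of it are infinite. Otherwise each cut leaves the member split by
    the other one essentially undivided, and the two halves of both members lie
    in suitable corners. The second corner of a pair appears through its
    complement, as a union. *)
Lemma splits_corners L X Y : splits L X -> splits L Y ->
  splits L (X `&` Y) /\ splits L (X `|` Y) \/
  splits L (X `&` ~` Y) /\ splits L (X `|` ~` Y).
Proof.
have quad (B P Q : set T) : infinite_set (B `&` P) ->
    infinite_set (B `&` (P `&` Q)) \/ infinite_set (B `&` (P `&` ~` Q)).
  move=> iP; have [fQ|?] := pselect (finite_set (B `&` (P `&` Q))); last by left.
  right=> fQ'; apply: iP.
  by rewrite -[P]setIT -(setUv Q) !setIUr finite_setU.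
have quad' (B P Q : set T) : infinite_set (B `&` Q) ->
    infinite_set (B `&` (P `&` Q)) \/ infinite_set (B `&` (~` P `&` Q)).
  by rewrite (setIC P) (setIC (~` P)); apply: quad.
have split_by (B P Q Z : set T) : L B -> infinite_set (B `&` P) ->
    infinite_set (B `&` Q) -> P `<=` Z -> Q `<=` ~` Z -> splits L Z.
  move=> LB iP iQ PZ QZ; exists B => //; split=> fin; [apply: iP|apply: iQ];
    by apply: sub_finite_set fin; apply: setIS.
have same (B : set T) : L B -> infinite_set (B `&` X) -> infinite_set (B `&` ~` X) ->
    infinite_set (B `&` Y) -> infinite_set (B `&` ~` Y) ->
  splits L (X `&` Y) /\ splits L (X `|` Y) \/
  splits L (X `&` ~` Y) /\ splits L (X `|` ~` Y).
  move=> LB iX iX' iY iY'.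
  have diag (Y1 : set T) : infinite_set (B `&` (X `&` Y1)) ->
      infinite_set (B `&` (~` X `&` ~` Y1)) ->
      splits L (X `&` Y1) /\ splits L (X `|` Y1).
    move=> i1 i2; split; apply: (split_by B (X `&` Y1) (~` X `&` ~` Y1)) => // x;
      rewrite /setC /=; tauto.
  have diag' : infinite_set (B `&` (X `&` ~` Y)) ->
      infinite_set (B `&` (~` X `&` Y)) ->
      splits L (X `&` ~` Y) /\ splits L (X `|` ~` Y).
    by move=> i1 i2; apply: diag; rewrite ?setCK.
  case: (quad B X Y iX) => i1; case: (quad B (~` X) Y iX') => i2.
  - by case: (quad' B X (~` Y) iY') => i3; [right; apply: diag'|left; apply: diag].
  - by left; apply: diag.
  - by right; apply: diag'.
  - by case: (quad' B X Y iY) => i3; [left; apply: diag|right; apply: diag'].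
move=> [B1 LB1 [iX iX']] [B2 LB2 [iY iY']].
have mono (B P Q : set T) : finite_set (B `&` Q) -> P `<=` Q ->
    ~ infinite_set (B `&` P).
  by move=> fQ PQ; apply; apply: sub_finite_set fQ; apply: setIS.
(* In the cases not covered by [same], the member [B1] split by [X] lies on one
   side [Y1] of [Y] up to finitely many points, and the member [B2] split by [Y]
   on one side [X1] of [X]. *)
have avoid1 (Y1 : set T) : finite_set (B1 `&` ~` Y1) ->
    infinite_set (B1 `&` (X `&` Y1)) /\ infinite_set (B1 `&` (~` X `&` Y1)).
  move=> f; have H P : ~ infinite_set (B1 `&` (P `&` ~` Y1)) by apply: mono f _ => x [].
  by case: (quad B1 X Y1 iX) (quad B1 (~` X) Y1 iX') => [i1|/H//] [i2|/H//].
have avoid2 (X1 : set T) : finite_set (B2 `&` ~` X1) ->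
    infinite_set (B2 `&` (X1 `&` Y)) /\ infinite_set (B2 `&` (X1 `&` ~` Y)).
  move=> f; have H P : ~ infinite_set (B2 `&` (~` X1 `&` P)) by apply: mono f _ => x [].
  by case: (quad' B2 X1 Y iY) (quad' B2 X1 (~` Y) iY') => [i1|/H//] [i2|/H//].
have by1 P Q Z := split_by B1 P Q Z LB1; have by2 P Q Z := split_by B2 P Q Z LB2.
have [f1|i1] := pselect (finite_set (B1 `&` ~` Y)).
  have [a1 a2] := avoid1 _ f1.
  have [f2|i2] := pselect (finite_set (B2 `&` ~` X)).
    have [b1 b2] := avoid2 _ f2.
    right; split; [apply: by2 b2 b1 _ _|apply: by1 a1 a2 _ _]
      => x; rewrite /setC /=; tauto.
  have [f2'|i2'] := pselect (finite_set (B2 `&` X)); last exact: same LB2 _ _ _ _.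
  have [|b1 b2] := avoid2 (~` X); first by rewrite setCK.
  left; split; [apply: by1 a1 a2 _ _|apply: by2 b1 b2 _ _]
    => x; rewrite /setC /=; tauto.
have [f1'|i1'] := pselect (finite_set (B1 `&` Y)); last exact: same LB1 _ _ _ _.
have [|a1 a2] := avoid1 (~` Y); first by rewrite setCK.
have [f2|i2] := pselect (finite_set (B2 `&` ~` X)).
  have [b1 b2] := avoid2 _ f2.
  left; split; [apply: by2 b1 b2 _ _|apply: by1 a1 a2 _ _]
    => x; rewrite /setC /=; tauto.
have [f2'|i2'] := pselect (finite_set (B2 `&` X)); last exact: same LB2 _ _ _ _.
have [|b1 b2] := avoid2 (~` X); first by rewrite setCK.
right; split; [apply: by1 a1 a2 _ _|apply: by2 b2 b1 _ _]
  => x; rewrite /setC /=; tauto.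
Qed.

(** A component [K a] of a minimal cut [X] has its boundary inside that of [X].
    As the components all meet the finite boundary of [X], one of them contains
    infinitely many points of the divided member of [L]; it is a cut, so its
    boundary is all of that of [X], and no room is left for another component. *)
Lemma minimal_cut_connected R L X : symmetric_rel R -> connected_in R setT ->
  minimal_cut R L X -> connected_in R X.
Proof.
move=> Rsym Rconn [[fX [B LB [iX iX']]] minX].
pose K a := [set y | reach R X a y].
have bK a : boundary R (K a) `<=` boundary R X.
  move=> [u v] [/= uv H]; split=> //=.
  have [Ku|nKu] := pselect (K a u).
    split=> [_ Xv|_]; last exact: reach_target Ku.
    by case: (H.1 Ku); apply: reach_step Ku uv Xv.
  have Kv : K a v by apply: contrapT => nKv; apply: nKu; apply/H.
  have Xv := reach_target Kv; split=> [Xu|//].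
  by case: nKu; apply: reach_step Kv (Rsym _ _ uv) Xu.
have [c [_ nXc]] : exists c, (B `&` ~` X) c.
  by apply: contrapT => H; apply: iX'; rewrite (_ : _ `&` _ = set0)//;
    apply/seteqP; split=> // c Hc; apply: H; exists c.
have exitK a : X a -> exists u v, [/\ K a u, ~ X v, R u v & boundary R X (u, v)].
  move=> Xa; have nKc : ~ K a c by move=> Kc; exact: nXc (reach_target Kc).
  have [u [v [_ Ku _ nKv uv]]] :=
    reach_exit (Rconn a c I I) (reach_refl R Xa : K a a) nKc.
  have nXv : ~ X v by move=> Xv; apply: nKv; apply: reach_step Ku uv Xv.
  by exists u, v; split=> //; split=> //=; split=> // _; exact: reach_target Ku.
have [a iK] : exists a, infinite_set (B `&` K a).
  apply: contrapT => nK; apply: iX.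
  apply: (@sub_finite_set _ _ (\bigcup_(p in boundary R X) (B `&` K p.1))).
    move=> x [Bx Xx]; have [u [v [Ku _ _ uv]]] := exitK x Xx.
    by exists (u, v) => //; split=> //; apply: reach_sym.
  by apply: bigcup_finite => // p _; apply: contrapT => iK; apply: nK; exists p.1.
have Xa : X a.
  apply: contrapT => nXa; apply: iK; rewrite (_ : _ `&` _ = set0)//.
  by apply/seteqP; split=> // c' [_ ac']; case: nXa; exact: reach_source ac'.
have cutK : splitting_cut R L (K a).
  split; first exact: sub_finite_set (bK a) fX.
  exists B => //; split=> // fin; apply: iX'; apply: sub_finite_set fin => x [Bx nXx].
  by split=> // Kx; exact: nXx (reach_target Kx).
have E := subset_ncard_eq fX (bK a) (minX _ cutK).
suff KX b : X b -> K a b.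
  by move=> x y Xx Xy; apply: reach_trans (KX _ Xy); apply: reach_sym (KX _ Xx).
move=> Xb; have [u [v [Ku nXv _]]] := exitK b Xb.
rewrite -E => -[/= uv H].
have Kau : K a u by apply/H => Kv; exact: nXv (reach_target Kv).
by apply: reach_trans Kau (reach_sym Rsym Ku).
Qed.

Lemma finite_separating_minimal_cuts R L x y :
  symmetric_rel R -> connected_in R setT ->
  finite_set [set X | [/\ minimal_cut R L X, X x & ~ X y]].
Proof.
move=> Rsym Rconn.
have [[X0 mX0]|no] := pselect (exists X, minimal_cut R L X); last first.
  rewrite (_ : mkset _ = set0) //; apply/seteqP; split=> // X [mX _ _].
  by apply: no; exists X.
apply: sub_finite_set (finite_tight_cuts x y (ncard (boundary R X0)) Rsym).
move=> X [mX Xx nXy]; split=> //; first exact: mX.1.1.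
- by apply: mX.2; exact: mX0.1.
- by split; apply: (@minimal_cut_connected R L) => //; apply: minimal_cutC.
Qed.

(** A connected cut that crosses [X] meets both [X] and its complement, so it
    contains an endpoint of the boundary of [X], and so does its complement.
    Hence it separates two of finitely many points. *)
Lemma crossing_finite R L X : symmetric_rel R -> connected_in R setT ->
  minimal_cut R L X -> finite_set (crossing R L X).
Proof.
move=> Rsym Rconn [[fX _] _].
pose F (pq : (T * T) * (T * T)) :=
  [set Y | [/\ minimal_cut R L Y, Y pq.1.1 & ~ Y pq.2.1]].
apply: (@sub_finite_set _ _ (\bigcup_(pq in boundary R X `*` boundary R X) F pq)).
  have meet Y : minimal_cut R L Y -> ~ nested X Y ->
      exists2 p, boundary R X p & Y p.1.
    move=> mY nXY.
    have [x [Xx Yx]] : exists x, X x /\ Y x.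
      apply: contrapT => H; apply: nXY; constructor 2 => x Xx Yx.
      by apply: H; exists x.
    have [y [nXy Yy]] : exists x, ~ X x /\ Y x.
      apply: contrapT => H; apply: nXY; constructor 4 => y nXy Yy.
      by apply: H; exists y.
    have [u [v [ru Xu _ nXv uv]]] :=
      reach_exit (minimal_cut_connected Rsym Rconn mY Yx Yy) Xx nXy.
    by exists (u, v); [split|exact: reach_target ru].
  move=> Y [mY nXY]; have [p bp Yp] := meet Y mY nXY.
  have [q bq nYq] : exists2 q, boundary R X q & ~ Y q.1.
    by apply: (meet (~` Y)); [exact: minimal_cutC|move/nestedCr].
  by exists (p, q).
by apply: bigcup_finite => [|pq _]; [exact: finite_setX|
  exact: finite_separating_minimal_cuts].
Qed.

(** Only the case where [W] contains one of the two complements and misses the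
    other is not immediate; it makes these complements disjoint, so that [X] and
    [Y] are nested. *)
Lemma nestedI X Y W : ~ nested X Y -> nested X W -> nested Y W ->
  nested (X `&` Y) W.
Proof.
move=> nXY.
have no P : (forall z, ~ X z -> P z) -> (forall z, ~ Y z -> ~ P z) -> False.
  move=> XP YP; apply: nXY; constructor 3 => z nXz; apply: contrapT => nYz.
  exact: YP nYz (XP _ nXz).
case=> XW; [by constructor 1 => x [/XW]|by constructor 2 => x [/XW]
  |case=> YW|case=> YW]; try (by constructor 1 => x [_ /YW]);
  try (by constructor 2 => x [_ /YW]).
- by constructor 3; rewrite setCI => x [/XW|/YW].
- by case: (no W XW YW).
- by case: (no (~` W) XW) => z /YW Wz; apply.
- by constructor 4; rewrite setCI => x [/XW|/YW].
Qed.

Lemma nestedU X Y W : ~ nested X Y -> nested X W -> nested Y W ->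
  nested (X `|` Y) W.
Proof.
move=> nXY XW YW; apply/nestedCl; rewrite setCU; apply: nestedI; try exact/nestedCl.
by move/nestedCl/nestedCr.
Qed.

Lemma nestedIU X Y W : nested X W -> nested (X `&` Y) W \/ nested (X `|` Y) W.
Proof.
case=> XW; [left; constructor 1|left; constructor 2|right; constructor 3
  |right; constructor 4] => x.
- by case=> /XW.
- by case=> /XW.
- by rewrite setCU => -[/XW].
- by rewrite setCU => -[/XW].
Qed.

(** The uncrossing step. Submodularity makes both corners minimal cuts. A cut
    crossing one corner crosses [X] or [Y], a cut crossing both corners crosses
    [X] and [Y], and [X] itself crosses [Y] but neither corner. So the corners
    together are crossed by fewer minimal cuts than [X] and [Y] together. *)
Lemma optimal_corners R L X Y : symmetric_rel R -> connected_in R setT ->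
  optimal_cut R L X -> optimal_cut R L Y -> ~ nested X Y ->
  splits L (X `&` Y) -> splits L (X `|` Y) -> False.
Proof.
move=> Rsym Rconn [mX oX] [mY oY] nXY sI sU.
have [[fX _] minX] := mX; have [[fY _] minY] := mY.
have cI : splitting_cut R L (X `&` Y) by split=> //; apply: boundary_finiteI.
have cU : splitting_cut R L (X `|` Y) by split=> //; apply: boundary_finiteU.
have sub := boundary_submodular fX fY.
have mI : minimal_cut R L (X `&` Y).
  split=> // Z cZ; move: (minX _ cU) (minY _ cU) (minX _ cZ) (minY _ cZ); lia.
have mU : minimal_cut R L (X `|` Y).
  split=> // Z cZ; move: (minX _ cI) (minY _ cI) (minX _ cZ) (minY _ cZ); lia.
have fin := crossing_finite Rsym Rconn.
have := leq_ncard_modular (fin _ _ mI) (fin _ _ mU) (finite_set1 X)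
  (fin _ _ mX) (fin _ _ mY).
rewrite ncard_set1 => H.
have {H} : ncard (crossing R L (X `&` Y)) + ncard (crossing R L (X `|` Y)) + 1 <=
  ncard (crossing R L X) + ncard (crossing R L Y).
  apply: H => W.
  have [->|/eqP WX] := eqVneq W X.
    rewrite (memNset (A := crossing R L (X `&` Y))); last first.
      by case=> _; apply; constructor 1 => x [].
    rewrite (memNset (A := crossing R L (X `|` Y))); last first.
      by case=> _; apply; constructor 4; rewrite setCU => x [].
    rewrite (mem_set (A := crossing R L Y)) ?addn1 ?addn0 ?leq_addl //.
      by case: (X \in _).
    by split=> // YX; apply: nXY; apply: nested_sym.
  rewrite [W \in [set X]]memNset // addn0.
  apply: leq_mem_modular => -[mW nW].
  - apply: contrapT => H; apply: nW; apply: nestedI => //; apply: contrapT => nW';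
      by apply: H; first [by left; split|by right; split].
  - apply: contrapT => H; apply: nW; apply: nestedU => //; apply: contrapT => nW';
      by apply: H; first [by left; split|by right; split].
  - move=> [_ nW']; split; split=> // XW.
      by have [] := nestedIU Y XW.
    by have [] := nestedIU X XW; rewrite ?(setIC Y) ?(setUC Y).
move: (oX _ mI) (oY _ mU); lia.
Qed.

Lemma optimal_cuts_nested R L X Y : symmetric_rel R -> connected_in R setT ->
  optimal_cut R L X -> optimal_cut R L Y -> nested X Y.
Proof.
move=> Rsym Rconn oX oY; apply: contrapT => nXY.
have [[sI sU]|[sI sU]] := splits_corners oX.1.1.2 oY.1.1.2.
  exact: (optimal_corners Rsym Rconn oX oY nXY sI sU).
apply: (optimal_corners Rsym Rconn oX (optimal_cutC oY) _ sI sU).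
by move/nestedCr.
Qed.

Lemma exists_optimal_cut R L : (exists X, splitting_cut R L X) ->
  exists X, optimal_cut R L X.
Proof.
move=> /(minimizer (fun X => ncard (boundary R X)))[X cX minX].
have : exists X, minimal_cut R L X by exists X; split.
by move=> /(minimizer (fun X => ncard (crossing R L X)))[Y mY oY]; exists Y; split.
Qed.

Definition automorphism R L (g : T -> T) : Prop :=
  (forall x y, R x y -> R (g x) (g y)) /\ (forall B, L B -> L (g @^-1` B)).

Lemma splitting_cut_preimage R L g h X : cancel g h -> cancel h g ->
  automorphism R L g -> automorphism R L h ->
  splitting_cut R L X -> splitting_cut R L (g @^-1` X) /\
    ncard (boundary R (g @^-1` X)) = ncard (boundary R X).
Proof.
move=> gK hK [gR gL] [hR hL] [fX [B LB [iX iX']]].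
pose gg (p : T * T) := (g p.1, g p.2); pose hh (p : T * T) := (h p.1, h p.2).
have ggK : cancel gg hh by move=> [x y]; rewrite /gg /hh /= !gK.
have hhK : cancel hh gg by move=> [x y]; rewrite /gg /hh /= !hK.
have E : boundary R (g @^-1` X) = gg @^-1` (boundary R X).
  apply/seteqP; split=> -[u v] [/= uv H]; split=> //=; first exact: gR.
  by rewrite -[u]gK -[v]gK; apply: hR.
have pre (A : set T) : infinite_set A -> infinite_set (g @^-1` A).
  move=> iA fA; apply: iA.
  rewrite (_ : A = g @` (g @^-1` A)); first exact: finite_image.
  by apply/seteqP; split=> [x Ax|_ [x Ax <-]//]; exists (h x); rewrite /preimage /= hK.
split; last by rewrite E (ncard_preimage _ ggK hhK).
split; last by exists (g @^-1` B); [exact: gL|split; [exact: pre iX|exact: pre iX']].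
by rewrite E; apply: finite_preimage fX; exact: in2W (can_inj ggK).
Qed.

Lemma minimal_cut_preimage R L g h X : cancel g h -> cancel h g ->
  automorphism R L g -> automorphism R L h ->
  minimal_cut R L X -> minimal_cut R L (g @^-1` X).
Proof.
move=> gK hK ag ah [cX mX]; have [cgX E] := splitting_cut_preimage gK hK ag ah cX.
by split=> // Y cY; rewrite E; apply: mX.
Qed.

Lemma nested_preimage (g : T -> T) X Y : nested X Y -> nested (g @^-1` X) (g @^-1` Y).
Proof.
by case=> XY; [constructor 1|constructor 2|constructor 3|constructor 4] => x; apply: XY.
Qed.

Lemma preimage_cancel (g h : T -> T) X : cancel g h -> g @^-1` (h @^-1` X) = X.
Proof. by move=> gK; apply/seteqP; split=> x; rewrite /preimage /= gK. Qed.

Lemma optimal_cut_preimage R L g h X : cancel g h -> cancel h g ->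
  automorphism R L g -> automorphism R L h ->
  optimal_cut R L X -> optimal_cut R L (g @^-1` X).
Proof.
move=> gK hK ag ah [mX oX]; split; first exact: minimal_cut_preimage mX.
suff -> : crossing R L (g @^-1` X) = (preimage h) @^-1` crossing R L X.
  move=> Y mY; rewrite (@ncard_preimage _ _ (preimage g)); first exact: oX.
    by move=> Z; exact: preimage_cancel.
  by move=> Z; exact: preimage_cancel.
apply/seteqP; split=> Y [mY nY].
  split; first exact: minimal_cut_preimage mY.
  by move=> /(nested_preimage g); rewrite (preimage_cancel _ gK).
split; last by move=> /(nested_preimage h); rewrite (preimage_cancel _ hK).
by rewrite -(preimage_cancel Y gK); apply: (@minimal_cut_preimage _ _ g h).
Qed.

End NestedCuts.

(** * Separations *)

Lemma finite_subsets (T : choiceType) (A : set T) :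
  finite_set A -> finite_set [set B | B `<=` A].
Proof.
move=> fA; apply: sub_finite_set
  (finite_image (fun s : {fset T} => [set` s]) (finite_fset (fpowerset (fset_set A)))).
move=> B /= BA; have fB := sub_finite_set BA fA.
exists (fset_set B); last exact: fset_setK.
by rewrite /= fpowersetE -fset_set_sub.
Qed.

Section Separations.
Variable T : choiceType.
Implicit Types (sep : T -> T -> T -> Prop) (E : set (set T)).

(** These are the laws of strict betweenness of vertices in a tree, with finite
    intervals. [sep_cases] says that lying in the same branch at [z] is an
    equivalence relation; [sep_asym] is what makes the structure tree-like. *)
Record separation sep : Prop := Separation {
  sep_neq : forall z x y, sep z x y -> [/\ x <> z, y <> z & x <> y];
  sep_sym : forall z x y, sep z x y -> sep z y x;
  sep_cases : forall z x y w, sep z x y -> w <> z -> sep z x w \/ sep z w y;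
  sep_asym : forall z x y, sep z x y -> ~ sep x z y;
  sep_finite : forall x y, finite_set [set z | sep z x y] }.

Lemma sep_antisym sep z x w : separation sep -> sep z x w -> ~ sep w x z.
Proof.
by move=> S /(sep_sym S)/(sep_asym S) n /(sep_sym S).
Qed.

Lemma sep_nest sep u z x y : separation sep ->
  sep u x z -> sep z x y -> sep u x y.
Proof.
move=> S uxz zxy; have nzxu := sep_antisym S uxz.
have [_ nzu _] := sep_neq S uxz.
have yu : y <> u.
  by move=> yu; apply: nzxu; rewrite -yu; case: (sep_antisym S zxy); rewrite yu.
have [//|/(sep_sym S)/(sep_asym S) nzuy] := sep_cases S uxz yu.
by have [] := sep_cases S zxy (nesym nzu).
Qed.

Lemma sep_total sep z w x y : separation sep -> z <> w ->
  sep z x y -> sep w x y -> sep z x w \/ sep w x z.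
Proof.
move=> S zw zxy wxy; have [|zwy] := sep_cases S zxy (nesym zw); first by left.
have [|wzy] := sep_cases S wxy zw; first by right.
by case: (sep_asym S zwy).
Qed.

(** The points between [x] and [y] are totally ordered by their distance from
    [x], so the first one is fixed by every automorphism that fixes [x] and [y].
    If there is none, [y] itself is next to [x]. *)
Lemma sep_gate sep x y : separation sep -> x <> y -> exists x1,
  [/\ x1 <> x, forall z, ~ sep z x x1
    & forall g h, cancel g h ->
        (forall z a b, sep z a b -> sep (g z) (g a) (g b)) ->
        (forall z a b, sep z a b -> sep (h z) (h a) (h b)) ->
        g x = x -> g y = y -> g x1 = x1].
Proof.
move=> S xy; have [|no] := pselect (exists z, sep z x y); last first.
  by exists y; split=> [/esym//|z xzy|//]; apply: no; exists z.
move=> /(minimizer (fun z => ncard [set u | sep u x z]))[x1 x1xy min].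
have closest u : ~ sep u x x1.
  move=> ux; have := min u (sep_nest S ux x1xy); have fin := sep_finite S x x1.
  move=> /(subset_ncard_eq fin) -E.
  have {}E : [set v | sep v x u] = [set v | sep v x x1].
    by apply: E => v /= /sep_nest; apply.
  have : [set v | sep v x x1] u by [].
  by rewrite -E /= => /(sep_neq S)[].
exists x1; split=> // [E|g h gK gS hS gx gy].
  by have [] := sep_neq S x1xy; rewrite E.
apply: contrapT => nE.
have gx1 : sep (g x1) x y by rewrite -gx -[in X in sep _ _ X]gy; apply: gS.
have [s|/closest//] := sep_total S (nesym nE) x1xy gx1.
have hx : h x = x by rewrite -[in LHS]gx gK.
by apply: (closest (h x1)); have := hS _ _ _ s; rewrite hx gK.
Qed.

(** For the edge cuts of a tree, two points other than [z] lie in the same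
    branch at [z] exactly if a cut contains both and avoids [z]. *)
Definition cut_sep E (z x y : T) : Prop :=
  [/\ x <> z, y <> z & forall e, E e -> ~ e z -> e x -> ~ e y].

Section NestedSeparation.
Variable E : set (set T).
Hypothesis E_nested : forall e f, E e -> E f -> nested e f.
Hypothesis EC : forall e, E e -> E (~` e).
Hypothesis E_separates : forall x y, x <> y -> exists e, [/\ E e, e x & ~ e y].
Hypothesis E_finite : forall x y, finite_set [set e | [/\ E e, e x & ~ e y]].

(** The intersection contains [x] and the union misses [z], which leaves only
    the two inclusions among the four ways of being nested. *)
Lemma nested_common e f x z : E e -> E f -> e x -> f x -> ~ e z -> ~ f z ->
  e `<=` f \/ f `<=` e.
Proof.
move=> Ee Ef ex fx nez nfz; case: (E_nested Ee Ef) => H; first by left.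
- by case: (H x).
- by case: nfz; apply: H.
by right=> y fy; apply: contrapT => /H.
Qed.

Lemma cut_sep_separation : separation (cut_sep E).
Proof.
split.
- move=> z x y [xz yz H]; split=> // xy.
  by have [e [Ee ex nez]] := E_separates xz; apply: (H e); rewrite -?xy.
- by move=> z x y [xz yz H]; split=> // e Ee nez ey /(H e Ee nez).
- move=> z x y w [xz yz H] wz; apply: contrapT => /not_orP[nxw nwy].
  have common a b : a <> z -> b <> z -> ~ cut_sep E z a b ->
      exists e, [/\ E e, ~ e z, e a & e b].
    move=> az bz nab; apply: contrapT => no; apply: nab; split=> // e Ee nez ea eb.
    by apply: no; exists e.
  have [e [Ee nez ex ew]] := common x w xz wz nxw.
  have [f [Ef nfz fw fy]] := common w y wz yz nwy.
  case: (nested_common Ee Ef ew fw nez nfz) => [ef|fe].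
    exact: (H f Ef nfz (ef _ ex) fy).
  exact: (H e Ee nez ex (fe _ fy)).
- move=> z x y [xz yz H] [_ yx H'].
  have [e [Ee ex nez]] := E_separates xz.
  by apply: (H' (~` e) (EC Ee)) => [/(_ ex)||/(H e Ee nez ex)].
move=> x y; pose c z := [set e | [/\ E e, e x & ~ e z]].
(* A point [z] is determined by the cuts that contain [x] and avoid [z]; if [z]
   lies between [x] and [y], these cuts also avoid [y]. *)
have c_inj : injective c.
  move=> z z' Ec; apply: contrapT => zz'.
  have [e [Ee ez nez']] := E_separates zz'; have [ex|nex] := pselect (e x).
    by have : c z' e by []; rewrite -Ec => -[].
  have : c z (~` e) by split=> //; exact: EC.
  by rewrite Ec => -[_ _]; apply.
apply: sub_finite_set (finite_preimage (in2W c_inj) (finite_subsets (E_finite x y))).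
by move=> z [_ _ H] e [Ee ex nez]; split=> //; apply: H ex.
Qed.

(** The cuts that contain [b] and avoid [a] form a finite chain. If no point of
    [B] were separated from [b], the largest of them would cover [B]; as it is
    contained in [B], it would be [B]. *)
Lemma cut_sep_splits (a b : T) (B : set T) : b <> a -> ~ B a -> ~ E B ->
  (forall e, E e -> e b -> ~ e a -> e `<=` B) ->
  exists2 x, B x & cut_sep E a b x.
Proof.
move=> ba nBa nEB subB; apply: contrapT => no; apply: nEB.
have [f [Ef fb nfa]] := E_separates ba; pose F := [set e | [/\ E e, e b & ~ e a]].
have [e [Ee eb nea] min] : exists2 e, F e & forall f, F f ->
    ncard [set g | F g /\ e `<=` g] <= ncard [set g | F g /\ f `<=` g].
  by apply: minimizer; exists f.
have largest g : F g -> g `<=` e.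
  move=> Fg; have [Eg gb nga] := Fg.
  have [eg|//] := nested_common Ee Eg eb gb nea nga.
  have fin : finite_set [set k | F k /\ e `<=` k].
    by apply: sub_finite_set (E_finite b a) => k [].
  have sub : [set k | F k /\ g `<=` k] `<=` [set k | F k /\ e `<=` k].
    by move=> k [Fk gk]; split=> //; apply: subset_trans gk.
  have eq := subset_ncard_eq fin sub (min g Fg).
  have : [set k | F k /\ e `<=` k] e by split.
  by rewrite -eq => -[].
suff -> : B = e by [].
apply/seteqP; split; last exact: subB.
move=> x Bx; apply: contrapT => nex; apply: no; exists x => //; split=> //.
  by move=> xa; apply: nBa; rewrite -xa.
by move=> g Eg nga gb /(largest g (And3 Eg gb nga)).
Qed.

End NestedSeparation.
End Separations.

(** * Odd closed walks *)

Section OddCycles.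
Variables (T : Type) (arc : T -> T -> Prop).
Hypothesis arc_irr : forall x, ~ arc x x.

Let adj x y := arc x y \/ arc y x.

(** A closed walk of length [n] is kept as an [n]-periodic sequence, so that it
    can be started at any of its vertices. *)
Definition closed_walk n (w : nat -> T) : Prop :=
  (forall k, adj (w k) (w k.+1)) /\ (forall k, w (k + n) = w k).

Lemma closed_walk_of w i d : 0 < d ->
  (forall k, k < d -> adj (w (i + k)) (w (i + k).+1)) ->
  w (i + d) = w i -> closed_walk d (fun k => w (i + k %% d)).
Proof.
move=> d0 wadj wd; split=> k; last by rewrite modnDr.
rewrite modnS; case: ifP => dk; last first.
  by rewrite addnS; apply: wadj; rewrite ltn_mod.
rewrite addn0 -wd; have -> : i + d = (i + k %% d).+1.
  move: dk; rewrite {1}(divn_eq k d) -addnS dvdn_addr ?dvdn_mull// => /dvdn_leq.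
  by have := ltn_pmod k d0; lia.
by apply: wadj; rewrite ltn_mod.
Qed.

(** A shortest odd closed walk does not repeat a vertex, so the two neighbours
    of each of its vertices [v] are connected outside [v] along the rest of the
    walk. As the length is odd, the directions of the arcs cannot alternate, and
    at some vertex one arc goes in and the other one goes out. *)
Lemma odd_closed_walk_turn n w : odd n -> closed_walk n w ->
  exists v o i, [/\ arc v o, arc i v & reach adj [set u | u <> v] o i].
Proof.
move=> on cw.
have [[m u] /= [om [uadj um]] min] : exists2 nw : nat * (nat -> T),
    odd nw.1 /\ closed_walk nw.1 nw.2 &
    forall nw', odd nw'.1 /\ closed_walk nw'.1 nw'.2 -> nw.1 <= nw'.1.
  by apply: minimizer; exists (n, w).
have adj_sym : symmetric_rel adj by move=> x y [] ?; [right|left].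
have short i d : 0 < d -> odd d -> u (i + d) = u i -> m <= d.
  move=> d0 od ud.
  apply: (min (d, fun k => u (i + k %% d))); split=> //=.
  exact: closed_walk_of.
have inj i d : 0 < d < m -> u (i + d) <> u i.
  move=> /andP[d0 dm] ud; have [od|ed] := boolP (odd d).
    by have := short i d d0 od ud; rewrite leqNgt dm.
  have := short (i + d) (m - d).
  rewrite -addnA subnKC ?(ltnW dm)// um ud subn_gt0 dm oddB ?(ltnW dm)// om (negPf ed).
  by move=> /(_ isT isT erefl); lia.
have m1 : m != 1.
  apply/eqP => m1; have := uadj 0; have := um 0; rewrite m1 => ->.
  by case=> /arc_irr.
have back k : reach adj [set x | x <> u k.+1] (u k.+2) (u k).
  rewrite -(um k) -(_ : k.+2 + (m - 2) = k + m); last by lia.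
  have : m - 2 <= m - 2 by [].
  elim: {1 3}(m - 2) => [_|j IH jm].
    by rewrite addn0; apply: reach_refl; rewrite /= -addn1; apply: inj; lia.
  apply: reach_step (IH (ltnW jm)) _ _; rewrite addnS; first exact: uadj.
  rewrite /= (_ : (k.+2 + j).+1 = k.+1 + (j + 2)); last by lia.
  by apply: inj; lia.
apply: contrapT => no.
pose a k := arc (u k) (u k.+1); pose b k := arc (u k.+1) (u k).
have ab k : a k -> b k.+1.
  move=> ak; case: (uadj k.+1) => // ak1; case: no.
  by exists (u k.+1), (u k.+2), (u k).
have ba k : b k -> a k.+1.
  move=> bk; case: (uadj k.+1) => // bk1; case: no.
  by exists (u k.+1), (u k), (u k.+2); split=> //; apply: reach_sym.
have alt k : (a 0 -> if odd k then b k else a k) /\ (b 0 -> if odd k then a k else b k).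
  elim: k => [//|k [IHa IHb]]; rewrite /=.
  case: (odd k) IHa IHb => /= IHa IHb; split=> [/IHa|/IHb];
    [exact: ba|exact: ab|exact: ab|exact: ba].
have [alta altb] := alt m; rewrite om in alta altb.
have am : a m = a 0 by rewrite /a -[m]add0n -addSn !um.
have bm : b m = b 0 by rewrite /b -[m]add0n -addSn !um.
have both : a 0 /\ b 0.
  by case: (uadj 0) => H; [split=> //; rewrite -bm; apply: alta
    |split=> //; rewrite -am; apply: altb].
case: no; exists (u 1), (u 2), (u 0).
by split; [exact: ba both.2|exact: both.1|exact: back].
Qed.

End OddCycles.

(** * Orbital digraphs of primitive groups *)

Section OrbitalDigraphs.
Variable T : choiceType.
Implicit Types (G : set (T -> T)) (D : digraph T).

Lemma adjacent_sym D : symmetric_rel (adjacent D).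
Proof. by move=> x y [] ?; [right|left]. Qed.

Lemma group_inverse G g : permutation_group G -> G g ->
  exists h, [/\ G h, cancel g h & cancel h g].
Proof.
move=> [bij _ _ inv] Gg; have [h gK hK] := bij g Gg.
by exists h; split=> //; apply: inv gK.
Qed.

Lemma orbital_digraph_exists G a b : permutation_group G -> a <> b ->
  exists2 D, orbital_digraph G D & arcs D = [set (g a, g b) | g in G].
Proof.
move=> Ggrp ab.
have irr x : ~ [set (g a, g b) | g in G] (x, x).
  move=> [g Gg [gx /esym gy]]; have [h [_ gK _]] := group_inverse Ggrp Gg.
  by apply: ab; rewrite -[a]gK gx gy gK.
by exists (@Digraph T setT [set (g a, g b) | g in G] (fun _ _ _ => conj I I) irr) => //;
  exists a, b.
Qed.

Lemma orbital_arc_image G D g u v : permutation_group G -> orbital_digraph G D ->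
  G g -> arcs D (u, v) -> arcs D (g u, g v).
Proof.
move=> [_ _ comp _] [a [b [_ _ ->]]] Gg [k Gk [<- <-]].
by exists (g \o k) => //; apply: comp.
Qed.

Lemma orbital_adjacent_image G D g u v : permutation_group G -> orbital_digraph G D ->
  G g -> adjacent D u v -> adjacent D (g u) (g v).
Proof.
by move=> Ggrp oD Gg [] uv; [left|right]; apply: orbital_arc_image Ggrp oD Gg uv.
Qed.

Lemma orbital_arc_transitive G D u v u' v' :
  permutation_group G -> orbital_digraph G D ->
  arcs D (u, v) -> arcs D (u', v') -> exists g, [/\ G g, g u = u' & g v = v'].
Proof.
move=> Ggrp [a [b [_ _ ->]]] [k Gk [<- <-]] [k' Gk' [<- <-]].
have [h [Gh kK hK]] := group_inverse Ggrp Gk.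
by exists (k' \o h); split; rewrite /= ?kK //; case: Ggrp => _ _ comp _; apply: comp.
Qed.

Lemma orbital_has_arc G D : permutation_group G -> orbital_digraph G D ->
  exists a b, arcs D (a, b).
Proof. by move=> [_ Gid _ _] [a [b [_ _ ->]]]; exists a, b, id. Qed.

Lemma invariant_reach_full G (R : T -> T -> Prop) a b : primitive_group G ->
  symmetric_rel R -> (forall g x y, G g -> R x y -> R (g x) (g y)) ->
  a <> b -> R a b -> connected_in R setT.
Proof.
move=> [Ggrp _ Gprim] Rsym GR ab Rab.
have [||triv|full] := Gprim (reach R setT); last by move=> x y _ _; exact: full.
- split=> [x|x y|x y z]; first exact: reach_refl; first exact: reach_sym.
  exact: reach_trans.
- move=> g Gg x y; split; first by apply: reach_map => [//|u v]; exact: GR.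
  have [h [Gh gK hK]] := group_inverse Ggrp Gg.
  by rewrite -{2}[x]gK -{2}[y]gK; apply: reach_map => [//|u v]; exact: GR.
by case: ab; apply/triv; apply: reach_edge.
Qed.

Lemma orbital_connected G D : primitive_group G -> orbital_digraph G D ->
  connected_in (adjacent D) setT.
Proof.
move=> Gprim oD; have Ggrp : permutation_group G by case: Gprim.
have [a [b ab]] := orbital_has_arc Ggrp oD.
apply: (@invariant_reach_full G _ a b) => //; last by left.
- exact: adjacent_sym.
- by move=> g x y Gg; exact: (orbital_adjacent_image Ggrp oD Gg).
- by move=> E; rewrite E in ab; exact: arcs_loopless ab.
Qed.

Lemma reach2_walk (R : T -> T -> Prop) x y :
  reach (fun u v => exists2 m, R u m & R m v) setT x y -> exists n w,
  [/\ w 0 = x, w n.*2 = y & forall k, k < n.*2 -> R (w k) (w k.+1)].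
Proof.
elim=> [_|u v _ [n [w [w0 wn wR]]] [m um mv] _]; first by exists 0, (fun _ => x).
exists n.+1, (fun k => if k <= n.*2 then w k else if k == n.*2.+1 then m else v).
rewrite doubleS; split=> [//||k kn]; first by rewrite ifN ?ifN_eq //; lia.
case: (ltngtP k n.*2) => [lt|gt|->].
- exact: wR.
- rewrite (_ : k = n.*2.+1) ?eqxx; last by lia.
  by rewrite ifN_eq //; lia.
by rewrite eqxx wn.
Qed.

(** Being joined by a walk of even length is an invariant equivalence relation.
    It is not equality, as some vertex has two neighbours, so by primitivity it
    holds between the two ends of an arc, and there is an odd closed walk. *)
Lemma primitive_turn G D : infinite_set [set: T] -> primitive_group G ->
  orbital_digraph G D -> exists v o i,
  [/\ arcs D (v, o), arcs D (i, v) & reach (adjacent D) [set u | u <> v] o i].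
Proof.
move=> Tinf Gprim oD; have Ggrp : permutation_group G by case: Gprim.
have Dcon := orbital_connected Gprim oD.
have Dsym := @adjacent_sym D.
have [a [b ab]] := orbital_has_arc Ggrp oD.
have anb : a <> b by move=> E; rewrite E in ab; exact: arcs_loopless ab.
pose R2 x z := exists2 y, adjacent D x y & adjacent D y z.
have R2sym : symmetric_rel R2 by move=> x z [y xy yz]; exists y; exact: Dsym.
(* Connectedness provides an edge from [a] or [b] to a third vertex. *)
have [x [z [xz xz2]]] : exists x z, x <> z /\ R2 x z.
  have [c ncab] : exists c, ~ [set a; b] c.
    apply: contrapT => no; apply: Tinf; apply: (@sub_finite_set _ _ [set a; b]) => //.
    by move=> c _; apply: contrapT => nc; apply: no; exists c.
  have [u [v [_ Cu _ nCv uv]]] :=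
    reach_exit (Dcon a c I I) (or_introl erefl : [set a; b] a) ncab.
  case: Cu => [ua|ub].
    exists v, b; split; first by move=> vb; apply: nCv; right.
    by exists a; [apply: Dsym; rewrite -ua|left].
  exists v, a; split; first by move=> va; apply: nCv; left.
  by exists b; [apply: Dsym; rewrite -ub|right].
have R2full : connected_in R2 setT.
  apply: (@invariant_reach_full G R2 x z) => // g s t Gg [r sr rt].
  by exists (g r); apply: (orbital_adjacent_image Ggrp oD).
have [n [w [w0 wn wadj]]] := reach2_walk (R2full a b I I).
pose u k := if k <= n.*2 then w k else a.
have cw := @closed_walk_of _ (fun x y => arcs D (x, y)) u 0 n.*2.+1 isT.
apply: odd_closed_walk_turn (cw _ _) => [s||k|]; rewrite ?add0n /u.
- exact: arcs_loopless.
- by rewrite /= odd_double.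
- rewrite ltnS => kn; rewrite kn; case: ltnP => nk; first exact: wadj.
  by rewrite (_ : k = n.*2) ?wn; [right|lia].
by rewrite ltnn leq0n w0.
Qed.

End OrbitalDigraphs.

(** * Bounded branching *)

Section Branches.
Variable T : choiceType.
Implicit Types (G : set (T -> T)) (D : digraph T) (sep : T -> T -> T -> Prop).

Definition invariant_sep G sep : Prop :=
  forall g, G g -> forall z x y, sep z x y -> sep (g z) (g x) (g y).

Definition separated_family sep (z : T) (t : seq T) : Prop :=
  (forall x, x \in t -> x <> z) /\
  (forall x y, x \in t -> y \in t -> x <> y -> sep z x y).

Lemma reach_not_sep R sep z x y : separation sep ->
  (forall u v, R u v -> ~ sep z u v) ->
  reach R [set u | u <> z] x y -> ~ sep z x y.
Proof.
move=> S nR; elim=> [_ /(sep_neq S)[] //|u v xu nxu uv _ zxv].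
have [/nxu//|/(nR _ _ uv)//] := sep_cases S zxv (reach_target xu).
Qed.

(** The component of [x] contains a neighbour of [a]. If this is an in-neighbour,
    the turn of [primitive_turn] can be moved to [a] in such a way that its
    in-neighbour becomes the given one. *)
Lemma orbital_component_out_neighbour G D a x : infinite_set [set: T] ->
  primitive_group G -> orbital_digraph G D -> x <> a ->
  exists2 o, arcs D (a, o) & reach (adjacent D) [set u | u <> a] x o.
Proof.
move=> Tinf Gprim oD xa; have [Ggrp Gtrans _] := Gprim.
pose C := [set y | reach (adjacent D) [set u | u <> a] x y].
have Cx : C x by apply: reach_refl.
have nCa : ~ C a by move=> Ca; case: (reach_target Ca).
have [u [v [_ xu _ nxv uv]]] :=
  reach_exit (orbital_connected Gprim oD (I : setT x) (I : setT a)) Cx nCa.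
have va : v = a by apply: contrapT => va; apply: nxv; apply: reach_step xu uv va.
rewrite {}va {nxv} in uv; case: uv => [ua|au]; last by exists u.
have [v' [o [i [vo iv oi]]]] := primitive_turn Tinf Gprim oD.
have [g [Gg gi gv]] := orbital_arc_transitive Ggrp oD iv ua.
exists (g o); first by rewrite -gv; apply: orbital_arc_image Ggrp oD Gg vo.
apply: reach_trans xu _; apply: reach_sym; first exact: adjacent_sym.
rewrite -gi; apply: reach_map oi => [w wv' gw|y w]; last first.
  exact: orbital_adjacent_image Ggrp oD Gg.
have [h [_ gK _]] := group_inverse Ggrp Gg.
by apply: wv'; rewrite -[w]gK gw -gv gK.
Qed.

(** The digraph is the orbital digraph of [(a, x1)], where [x1] is the point next
    to [a] on the way to [b]. Points of a separated family at [a] lie in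
    different components of the digraph without [a], each of which contains some
    [k x1] with [k] in the stabiliser of [a]. Then [k b] determines [k x1],
    because the stabiliser of [a] and [b] fixes [x1]. *)
Lemma gate_orbital G sep a b : infinite_set [set: T] -> primitive_group G ->
  separation sep -> invariant_sep G sep -> a <> b ->
  exists D, [/\ orbital_digraph G D,
    forall u v z, adjacent D u v -> ~ sep z u v
  & forall z t (s : seq T), uniq t -> separated_family sep z t ->
      orbit_of (point_stabiliser G a) b `<=` [set` s] -> size t <= size s].
Proof.
move=> Tinf Gprim S Sinv ab; have [Ggrp Gtrans _] := Gprim.
have [_ _ Gcomp _] := Ggrp.
have [x1 [x1a nosep fix1]] := sep_gate S ab.
have [D oD arcsE] := orbital_digraph_exists Ggrp (nesym x1a).
have noarc u v z : arcs D (u, v) -> ~ sep z u v.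
  rewrite arcsE => -[g Gg [<- <-]]; have [h [Gh gK hK]] := group_inverse Ggrp Gg.
  by move=> /(Sinv h Gh); rewrite !gK; apply: nosep.
have noadj u v z : adjacent D u v -> ~ sep z u v.
  by case=> [|vu /(sep_sym S)]; apply: noarc.
exists D; split=> // z t s ut [tz tsep] orb.
have [g [Gg gz]] : exists g, G g /\ g z = a by have [g] := Gtrans z a; exists g.
have [h [Gh gK hK]] := group_inverse Ggrp Gg.
have ex x : exists k, x \in t -> [/\ G k, k a = a
    & reach (adjacent D) [set u | u <> a] (g x) (k x1)].
  have [xt|_] := boolP (x \in t); last by exists id.
  have gxa : g x <> a by rewrite -gz => /(can_inj gK)/(tz x xt).
  have [o] := orbital_component_out_neighbour Tinf Gprim oD gxa.
  by rewrite arcsE => -[k Gk [ka <-]] xo; exists k.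
have [k kP] := choice ex.
rewrite -(size_map (fun x => k x b)); apply: uniq_leq_size; last first.
  move=> _ /mapP[x xt ->]; have [Gk ka _] := kP x xt.
  by apply: orb; exists (k x).
rewrite map_inj_in_uniq // => x y xt yt E; apply: contrapT => xy.
have [Gkx kxa xr] := kP x xt; have [Gky kya yr] := kP y yt.
have [l [Gl kK lK]] := group_inverse Ggrp Gky.
have [l' [Gl' kxK lxK]] := group_inverse Ggrp Gkx.
have fixed : (l \o k x) x1 = x1.
  apply: (fix1 (l \o k x) (l' \o k y)).
  - by move=> w; rewrite /= lK kxK.
  - by move=> w u v; apply: Sinv; apply: Gcomp.
  - by move=> w u v; apply: Sinv; apply: Gcomp.
  - by rewrite /= kxa -[in LHS]kya kK.
  - by rewrite /= E kK.
have Ex1 : k x x1 = k y x1 by rewrite -{2}fixed /= lK.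
apply: (reach_not_sep S (z := a) (fun u v => @noadj u v a)
  (reach_trans xr (reach_sym (@adjacent_sym _ D) (_ : reach _ _ (g y) _)))).
  by rewrite Ex1; exact: yr.
by rewrite -gz; apply: Sinv => //; apply: tsep.
Qed.

End Branches.

(** * Lobes and ends *)

Section Lobes.
Variable T : choiceType.
Implicit Types (D H K : digraph T) (W X : set T).

Lemma reach_path (R : T -> T -> Prop) X x y : reach R X x y ->
  exists p, [/\ path (fun u v => `[< R u v >]) x p, last x p = y,
    uniq (x :: p) & forall z, z \in x :: p -> X z].
Proof.
move=> xy.
have [q [Rq qy Xq]] : exists q, [/\ path (fun u v => `[< R u v >]) x q,
    last x q = y & forall z, z \in x :: q -> X z].
  elim: xy => [Xx|u v _ [q [Rq qu Xq]] uv Xv].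
    by exists [::]; split=> // z; rewrite inE => /eqP->.
  exists (rcons q v); rewrite last_rcons rcons_path Rq qu; split=> //.
    exact/asboolP.
  by move=> z; rewrite -rcons_cons mem_rcons inE => /orP[/eqP->//|/Xq].
move: qy; case: (shortenP Rq) => p Rp up sub py; exists p; split=> // z.
rewrite inE => /orP[/eqP->|/sub zq]; first by apply: Xq; exact: mem_head.
by apply: Xq; rewrite inE zq orbT.
Qed.

Lemma path_reach (R : T -> T -> Prop) X x p : path (fun u v => `[< R u v >]) x p ->
  (forall z, z \in x :: p -> X z) -> reach R X x (last x p).
Proof.
elim: p x => [|y p IH] x /=.
  by move=> _ Xx; apply: reach_refl; apply: Xx; rewrite inE.
move=> /andP[/asboolP xy yp] Xp.
have Xx : X x by apply: Xp; exact: mem_head.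
have Xyp z : z \in y :: p -> X z by move=> zp; apply: Xp; rewrite inE zp orbT.
apply: reach_trans (IH _ yp Xyp); apply: reach_edge => //.
by apply: Xyp; exact: mem_head.
Qed.

Lemma connectedP D : connected D <-> connected_in (adjacent D) (vertices D).
Proof.
split=> con x y Dx Dy.
  have [p [_ Rp _] <-] := con x y Dx Dy; apply: path_reach => // z.
  elim: p x Dx Rp => [|v p IH] x Dx /=; first by rewrite inE => _ /eqP->.
  move=> /andP[/asboolP xv vp]; rewrite inE => /orP[/eqP->//|].
  have Dv : vertices D v by case: xv => xv; have [] := arcs_vertices xv.
  exact: IH Dv vp.
have [p [Rp py up _]] := reach_path (con x y Dx Dy).
by exists p.
Qed.

Lemma adjacent_delete D W x y :
  adjacent (delete_vertices D W) x y <-> [/\ adjacent D x y, ~ W x & ~ W y].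
Proof.
split=> [[]|[[xy|yx] Wx Wy]]; [case=> /= xy Wx Wy|case=> /= yx Wy Wx| |].
- by split=> //; left.
- by split=> //; right.
- by left; split.
- by right; split.
Qed.

Lemma connected_deleteP D W : connected (delete_vertices D W) <->
  connected_in (adjacent D) (vertices D `\` W).
Proof.
split=> [/connectedP|] con; last apply/connectedP; move=> x y Dx Dy.
  by apply: reach_sub (con x y Dx Dy) => // u v _ _ /adjacent_delete[].
by apply: reach_sub (con x y Dx Dy) => // u v [_ Wu] [_ Wv] uv; apply/adjacent_delete.
Qed.

Definition nonseparable H : Prop := forall W, is_subset1 W ->
  connected_in (adjacent H) (vertices H `\` W).

Lemma subset1_card_le W : is_subset1 W <-> W #<= `I_1.
Proof.
split=> [W1|W1 x y Wx Wy].
  have [[x Wx]|no] := pselect (exists x, W x).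
    rewrite (_ : W = [set x]); first by rewrite (card_le_eql card_set1) card_lexx.
    by apply/seteqP; split=> [y Wy|_ ->//]; exact: W1.
  rewrite (_ : W = set0) ?card_le_emptyl //.
  by apply/seteqP; split=> // x Wx; apply: no; exists x.
have fW : finite_set W := card_le_finite W1 (finite_II 1).
have xW : [set x] `<=` W by move=> _ ->.
have := subset_ncard_eq fW xW; rewrite ncard_set1 => /(_ (geq_card_fset_set W1)) E.
by move: Wy; rewrite -E => ->.
Qed.

Lemma lobe_candidateP H : lobe_candidate H <->
  (exists a b, [/\ vertices H a, vertices H b & a <> b]) /\ nonseparable H.
Proof.
split=> [[con two gt]|[two ns]].
  split=> // W W1; have W1' : (W `&` vertices H) #<= `I_1.
    by apply/subset1_card_le => x y [Wx _] [Wy _]; exact: W1.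
  have : connected (delete_vertices H (W `&` vertices H)).
    by apply: contrapT => ncon; apply: (gt (W `&` vertices H)) => //; split=> // x [].
  by move/connected_deleteP; rewrite setDIr setDv setU0.
split=> //.
  by apply/connectedP; rewrite -[vertices H]setD0; apply: ns => x y [].
by move=> W [_ ncon] /subset1_card_le/ns con; apply: ncon; apply/connected_deleteP.
Qed.

Lemma subgraph_adjacent H D x y : subgraph H D -> adjacent H x y -> adjacent D x y.
Proof. by move=> [_ HD] [/HD|/HD]; [left|right]. Qed.

(** A path of [D] between two vertices of a lobe [H] is absorbed by [H]: together
    they still have no cut vertex, since a vertex of the path can be reached from
    either end of the path, and a single deleted vertex, not being that vertex
    itself, blocks at most one of the two ways. *)
Lemma lobe_add_path D H u p : vertices D = setT -> lobe D H ->
  vertices H u -> vertices H (last u p) -> upath D u p ->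
  subgraph (delete_vertices D (~` (vertices H `|` [set` u :: p]))) H.
Proof.
move=> DT [HD Hcand Hmax] Hu Hv [_ Dp up].
have [[a [b [Ha Hb ab]]] Hns] := (lobe_candidateP H).1 Hcand.
set S := vertices H `|` [set` u :: p].
have VK : vertices (delete_vertices D (~` S)) = S by rewrite /= DT setTD setCK.
have AK x y : S x -> S y -> adjacent D x y -> adjacent (delete_vertices D (~` S)) x y.
  by move=> Sx Sy xy; apply/adjacent_delete; split=> //; apply.
apply: Hmax.
- by split=> [x _|e [De _ _]]; [rewrite DT|exact: De].
- apply/lobe_candidateP; split; first by exists a, b; rewrite VK; split=> //; left.
  move=> W W1; rewrite VK.
  suff con : connected_in (adjacent D) (S `\` W).
    move=> x y Sx Sy; apply: reach_sub (con x y Sx Sy) => // s t [Ss _] [St _].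
    exact: AK.
  have toH x : (S `\` W) x -> exists2 y, (vertices H `\` W) y &
      reach (adjacent D) (S `\` W) x y.
    move=> [Sx nWx]; case: (Sx) => [Hx|/= xp].
      by exists x => //; apply: reach_refl.
    have Sp z : z \in u :: p -> S z by move=> zp; right.
    move: Dp up Hv Sp; case/splitPl: xp => p1 p2 p1x; rewrite cat_path last_cat.
    rewrite -cat_cons cat_uniq p1x => /andP[Dp1 Dp2] /and3P[_ /hasPn dis _] Hv Sp.
    have p1S z : z \in u :: p1 -> z \in u :: p1 ++ p2.
      by rewrite -cat_cons mem_cat => ->.
    have p2S z : z \in x :: p2 -> z \in u :: p1 ++ p2.
      rewrite inE => /orP[/eqP->|zp2]; first by apply: p1S; rewrite -p1x mem_last.
      by rewrite -cat_cons mem_cat zp2 orbT.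
    (* The two ways from [x] to [H] share only [x], which is not in [W]. *)
    have [[w [Ww wp1]]|no1] := pselect (exists w, W w /\ w \in u :: p1).
      have no2 z : z \in x :: p2 -> ~ W z.
        rewrite inE => /orP[/eqP->//|zp2] Wz; move: (dis z zp2).
        by rewrite (W1 z w Wz Ww) wp1.
      exists (last x p2); first by split=> //; apply: no2; exact: mem_last.
      by apply: path_reach Dp2 _ => z zp2; split; [apply/Sp/p2S|exact: no2].
    have no1' z : z \in u :: p1 -> ~ W z by move=> zp1 Wz; apply: no1; exists z.
    exists u; first by split=> //; apply: no1'; exact: mem_head.
    apply: reach_sym; first exact: adjacent_sym.
    rewrite -p1x; apply: path_reach Dp1 _ => z zp1.
    by split; [apply/Sp/p1S|exact: no1'].
  move=> x y Sx Sy; have [x' Hx' xx'] := toH x Sx; have [y' Hy' yy'] := toH y Sy.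
  apply: reach_trans xx' _; apply: reach_trans (reach_sym (@adjacent_sym _ D) yy').
  apply: reach_sub (Hns W W1 x' y' Hx' Hy') => [z [Hz nWz]|z w _ _].
    by split=> //; left.
  exact: subgraph_adjacent.
- split=> [x Hx|[x y] xy]; first by rewrite VK; left.
  have [Hx Hy] := arcs_vertices xy.
  by split; [exact: HD.2|apply; left|apply; left].
Qed.

Definition path_closed D H : Prop := forall u p, vertices H u ->
  vertices H (last u p) -> upath D u p -> upath H u p.

(** Absorbing the path of length zero at [x] turns [H] into an induced subgraph. *)
Lemma lobe_induced D H x y : vertices D = setT -> lobe D H ->
  vertices H x -> vertices H y -> adjacent D x y -> adjacent H x y.
Proof.
move=> DT lH Hx Hy xy.
have [_ sub] : subgraph (delete_vertices D (~` (vertices H `|` [set` [:: x]]))) H.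
  by apply: lobe_add_path => //; split; rewrite ?DT.
by case: xy => xy; [left|right]; apply: sub; split=> //; apply; left.
Qed.

Lemma lobe_path_closed D H : vertices D = setT -> lobe D H -> path_closed D H.
Proof.
move=> DT lH u p Hu Hv Dp; have [sub _] := lobe_add_path DT lH Hu Hv Dp.
have Hp z : z \in u :: p -> vertices H z.
  by move=> zp; apply: sub; split; [rewrite DT|apply; right].
case: Dp => _ Dp up; split=> //.
elim: p u Dp Hp {Hu Hv sub up} => //= y p IH u /andP[/asboolP uy yp] Hp.
rewrite IH // => [|z zp]; last by apply: Hp; rewrite inE zp orbT.
rewrite andbT; apply/asboolP; apply: lobe_induced lH _ _ uy => //; apply: Hp.
  exact: mem_head.
by rewrite !inE eqxx orbT.
Qed.

Lemma not_at_most_one_end H : ~ at_most_one_end H -> exists r s,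
  [/\ half_line H r, half_line H s & ~ half_line_equiv H r s].
Proof.
move=> n1; apply: contrapT => no; apply: n1 => e f [r hr ->] [s hs ->].
have all_equiv a b : half_line H a -> half_line H b -> half_line_equiv H a b.
  by move=> ha hb; apply: contrapT => nab; apply: no; exists a, b.
by apply/seteqP; split=> t [ht _]; split=> //; apply: all_equiv.
Qed.

(** If paths avoiding any given finite set existed, choosing each path so as to
    avoid all earlier ones would give infinitely many disjoint paths. *)
Lemma inequivalent_separated H r s : ~ half_line_equiv H r s ->
  exists F : seq T, forall p, connecting_path H r s p -> exists2 x, x \in p & x \in F.
Proof.
move=> nrs; apply: contrapT => no; apply: nrs.
have ex (F : seq T) : exists p,
    connecting_path H r s p /\ forall x, x \in p -> x \notin F.
  apply: contrapT => nop; apply: no; exists F => p rsp; apply: contrapT => nF.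
  apply: nop; exists p; split=> // x xp; apply/negP => xF; apply: nF.
  by exists x.
have [f fP] := choice ex.
pose used := fix used n := if n is n.+1 then used n ++ f (used n) else [::].
pose q n := f (used n).
have used_mono m n x : m <= n -> x \in used m -> x \in used n.
  move=> /subnK<-; elim: (n - m) => [//|k IH] /IH; rewrite addSn /= mem_cat => -> //.
have disj m n x : m < n -> x \in q m -> x \notin q n.
  move=> mn xm; apply/negP => /((fP (used n)).2) /negP; apply.
  by apply: used_mono mn _; rewrite /= mem_cat xm orbT.
have disj' m n x : m <> n -> x \in q m -> x \notin q n.
  move=> /eqP; rewrite neq_ltn => /orP[mn|nm] xm; first exact: disj mn xm.
  by apply/negP => xn; have := disj _ _ _ nm xn; rewrite xm.
have qinj : injective q.
  move=> m n E; apply: contrapT => mn.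
  have [[a [l [ql _ _ _]]] _] := fP (used m).
  have am : a \in q m by rewrite /q ql mem_head.
  by have := disj' m n a mn am; rewrite -E am.
exists (range q); split.
- move=> fin; apply: infinite_nat.
  by rewrite -(preimage_range q); apply: finite_preimage fin; exact: in2W qinj.
- by move=> _ [n _ <-]; exact: (fP (used n)).1.
move=> _ _ [m _ <-] [n _ <-] mn x xm; apply: disj' xm => E; apply: mn; by rewrite E.
Qed.

(** The cut consists of the vertices that can be reached from [r] outside a
    finite set [F] that separates the half-lines [r] and [s]. Paths of [D] that
    join [r] to [s] lie in [H], hence meet [F]. *)
Lemma ends_give_cut D H : vertices D = setT -> locally_finite D -> path_closed D H ->
  ~ at_most_one_end H -> exists C : set T, [/\ finite_set (boundary (adjacent D) C),
    infinite_set (vertices H `&` C) & infinite_set (vertices H `&` ~` C)].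
Proof.
move=> DT lf pc /not_at_most_one_end[r [s [[rinj radj] [sinj sadj] nrs]]].
have [F FP] := inequivalent_separated nrs.
have vert (w : nat -> T) n : (forall k, adjacent H (w k) (w k.+1)) -> vertices H (w n).
  by move=> wadj; case: (wadj n) => wn; have [] := arcs_vertices wn.
have infw (w : nat -> T) X : injective w -> (forall k, adjacent H (w k) (w k.+1)) ->
    (forall n, w n \notin F -> X (w n)) -> infinite_set (vertices H `&` X).
  move=> winj wadj wX fin; apply: infinite_nat; rewrite -(preimage_range w).
  apply: finite_preimage; first exact: in2W winj.
  apply: (@sub_finite_set _ _ ([set` F] `|` (vertices H `&` X))).
    move=> _ [n _ <-]; case: (boolP (w n \in F)) => wF; first by left.
    by right; split; [exact: vert|exact: wX].
  by rewrite finite_setU; split=> //; exact: finite_seq.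
pose C := [set x | exists2 n, r n \notin F &
  reach (adjacent D) [set y | y \notin F] (r n) x].
have nCs k : ~ C (s k).
  move=> [n rF /reach_path[p [Dp ps up pF]]].
  have Hp : upath H (r n) p.
    by apply: pc; [exact: vert|rewrite ps; exact: vert|split; rewrite ?DT].
  have [|x xp xF] := FP (r n :: p).
    by exists (r n), p; split=> //; rewrite ps; exists k.
  by have := pF x xp; rewrite /= xF.
exists C; split.
- pose N := \bigcup_(a in [set` F]) [set b | adjacent D a b].
  have fF : finite_set [set` F] by exact: finite_seq.
  have fN : finite_set N.
    by apply: bigcup_finite => // a _; apply: lf; rewrite DT.
  have exitF u v : C u -> ~ C v -> adjacent D u v -> v \in F.
    move=> [n rF ru] nCv uv; apply: contrapT => /negP vF; apply: nCv; exists n => //.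
    exact: reach_step ru uv vF.
  apply: (@sub_finite_set _ _ (([set` F] `*` N) `|` (N `*` [set` F]))).
    move=> [u v] [/= uv H']; have [Cu|nCu] := pselect (C u).
      right; have vF := exitF u v Cu (H'.1 Cu) uv; split=> //=; exists v => //.
      exact: adjacent_sym.
    have Cv : C v by apply: contrapT => /H'.
    left; have uF := exitF v u Cv nCu (adjacent_sym uv); split=> //=.
    by exists u.
  by rewrite finite_setU; split; exact: finite_setX.
- by apply: infw rinj radj _ => n nF; exists n => //; apply: reach_refl.
- by apply: infw sinj sadj _ => n _; exact: nCs.
Qed.

End Lobes.

(** * Separations from optimal cuts *)

Section Refinement.
Variable T : choiceType.
Variables (G : set (T -> T)) (D : digraph T) (L : set (set T)).
Hypothesis G_primitive : primitive_group G.
Hypothesis D_orbital : orbital_digraph G D.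
Hypothesis L_invariant : forall g B, G g -> L B -> L (g @^-1` B).
Hypothesis L_cut : exists C, splitting_cut (adjacent D) L C.

Let E := optimal_cut (adjacent D) L.

Let G_group : permutation_group G. Proof. by case: G_primitive. Qed.
Let D_sym : symmetric_rel (adjacent D). Proof. exact: adjacent_sym. Qed.
Let D_connected : connected_in (adjacent D) setT.
Proof. exact: orbital_connected G_primitive D_orbital. Qed.

Lemma optimal_cut_connected e : E e -> connected_in (adjacent D) e.
Proof. by case=> me _; apply: minimal_cut_connected me. Qed.

Let E_invariant g e : G g -> E e -> E (g @^-1` e).
Proof.
move=> Gg; have [h [Gh gK hK]] := group_inverse G_group Gg.
have aut k : G k -> automorphism (adjacent D) L k.
  move=> Gk; split=> [x y|B]; last exact: L_invariant.
  exact: (orbital_adjacent_image G_group D_orbital Gk).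
exact: (optimal_cut_preimage gK hK (aut g Gg) (aut h Gh)).
Qed.

(** Not being distinguished by any optimal cut is an invariant equivalence
    relation. It is not universal, because a splitting cut has points on both
    sides. *)
Let E_separates x y : x <> y -> exists e, [/\ E e, e x & ~ e y].
Proof.
move=> xy; have [_ _ prim] := G_primitive.
have [|||full] := prim (fun u v => forall e, E e -> e u <-> e v).
- split=> [u e //|u v uv e Ee|u v w uv vw e Ee]; first by split=> /(uv e Ee).
  by split=> [/(uv e Ee)/(vw e Ee)|/(vw e Ee)/(uv e Ee)].
- move=> g Gg u v; split=> uv e Ee; first exact: (uv _ (E_invariant Gg Ee)).
  have [h [Gh gK hK]] := group_inverse G_group Gg.
  by have := uv _ (E_invariant Gh Ee); rewrite /preimage /= !gK.
- move=> triv; apply: contrapT => no; apply: xy; apply/triv => e Ee.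
  split=> [ex|ey]; apply: contrapT => ne; apply: no; first by exists e.
  by exists (~` e); split=> //; exact: optimal_cutC.
have [e oe] := exists_optimal_cut L_cut.
have [B _ [ie ie']] : splits L e := oe.1.1.2.
have [u [_ eu]] := infinite_setN0 ie; have [v [_ nev]] := infinite_setN0 ie'.
by case: nev; apply/(full u v e oe).
Qed.

Let E_nested e f : E e -> E f -> nested e f.
Proof. exact: optimal_cuts_nested. Qed.

Let E_C e : E e -> E (~` e).
Proof. exact: optimal_cutC. Qed.

Let E_finite x y : finite_set [set e | [/\ E e, e x & ~ e y]].
Proof.
apply: sub_finite_set (finite_separating_minimal_cuts L x y D_sym D_connected).
by move=> e [[me _] ex ney].
Qed.

Lemma optimal_separation : separation (cut_sep E).
Proof. exact: cut_sep_separation. Qed.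

Lemma optimal_separation_invariant : invariant_sep G (cut_sep E).
Proof.
move=> g Gg z x y [xz yz H]; have [h [Gh gK hK]] := group_inverse G_group Gg.
split; try by move/(can_inj gK).
by move=> e Ee nez ex; exact: (H _ (E_invariant Gg Ee)).
Qed.

(** An optimal cut that contains [x] and [y] but not [z] would connect them
    outside [z]. *)
Lemma optimal_separation_refines z x y : x <> z -> y <> z ->
  ~ reach (adjacent D) [set u | u <> z] x y -> cut_sep E z x y.
Proof.
move=> xz yz nxy; split=> // e Ee nez ex ey; apply: nxy.
apply: reach_setS (optimal_cut_connected Ee ex ey) => u eu uz.
by apply: nez; rewrite -uz.
Qed.

Lemma optimal_separation_splits z b (B : set T) : b <> z -> ~ B z -> ~ splits L B ->
  (forall e, connected_in (adjacent D) e -> e b -> ~ e z -> e `<=` B) ->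
  exists2 x, B x & cut_sep E z b x.
Proof.
move=> bz nBz nB sub; apply: cut_sep_splits => // [[mB _]|e Ee eb nez].
  exact: nB mB.1.2.
exact: sub (optimal_cut_connected Ee) eb nez.
Qed.

End Refinement.

(** * Connectivity and lobes of the chosen digraph *)

Lemma orbital_locally_finite (T : choiceType) (G : set (T -> T)) (D : digraph T) :
  permutation_group G -> no_infinite_subdegree G -> orbital_digraph G D ->
  locally_finite D.
Proof.
move=> Ggrp Gfin oD a _.
have half (arc : T -> T -> Prop) :
    (forall b c, arc a b -> arc a c -> exists g, [/\ G g, g a = a & g b = c]) ->
    finite_set [set b | arc a b].
  move=> trans; have [[b ab]|no] := pselect (exists b, arc a b); last first.
    rewrite (_ : mkset _ = set0) //.
    by apply/seteqP; split=> // b ab; apply: no; exists b.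
  apply: sub_finite_set (Gfin a b) => c ac; have [g [Gg ga gb]] := trans b c ab ac.
  by exists g.
rewrite (_ : mkset _ = [set b | arcs D (a, b)] `|` [set b | arcs D (b, a)]); last first.
  by [].
rewrite finite_setU; split.
  by apply: (half (fun x y => arcs D (x, y))) => b c; exact: orbital_arc_transitive.
apply: (half (fun x y => arcs D (y, x))) => b c ba ca.
by have [g [Gg gb ga]] := orbital_arc_transitive Ggrp oD ba ca; exists g.
Qed.

Lemma separated_connectivity1 (T : choiceType) (D : digraph T) z x y :
  infinite_set [set: T] -> vertices D = setT -> connected_in (adjacent D) setT ->
  x <> z -> y <> z -> ~ reach (adjacent D) [set u | u <> z] x y ->
  has_connectivity D 1.
Proof.
move=> Tinf DT con xz yz nxy; split.
- by rewrite DT.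
- by apply/connectedP; rewrite DT.
- exists [set z]; last exact: card_set1.
  split=> [u _|/connected_deleteP]; rewrite DT // => /(_ x y) con'.
  by apply: nxy; apply: reach_setS (con' _ _) => //= u [].
move=> W [_ nW]; have [[w Ww]|no] := pselect (exists w, W w).
  rewrite -(card_le_eql (card_set1 (x := w))); apply: subset_card_le.
  by move=> _ ->.
case: nW; apply/connected_deleteP; rewrite (_ : W = set0) ?setD0 ?DT //.
by apply/seteqP; split=> // w Ww; apply: no; exists w.
Qed.

(** A translate of [H] stays connected when [z] is deleted, so apart from [z] it
    lies entirely inside or entirely outside the component of [b]. *)
Lemma lobe_component_not_split (T : choiceType) (G : set (T -> T)) (D H : digraph T)
  z b : permutation_group G -> orbital_digraph G D -> subgraph H D -> nonseparable H ->
  ~ splits [set g @^-1` vertices H | g in G]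
      [set y | reach (adjacent D) [set u | u <> z] b y].
Proof.
move=> Ggrp oD HD Hns [_ [g Gg <-] [iB iB']].
have [h [Gh gK hK]] := group_inverse Ggrp Gg.
have [w [Hw bw]] := infinite_setN0 iB; have wz : w <> z := reach_target bw.
apply: iB'.
apply: sub_finite_set (finite_set1 z) => y [Hy nby] /=.
apply: contrapT => yz; apply: nby; apply: reach_trans bw _.
have one : is_subset1 [set g z] by move=> u v -> ->.
rewrite -[w]gK -[y]gK; apply: (@reach_map _ _ (vertices H `\ g z)).
- by move=> u [_ ugz] huz; apply: ugz; rewrite /= -huz hK.
- by move=> u v; exact: orbital_adjacent_image Ggrp oD Gh.
apply: reach_sub (Hns _ one (g w) (g y) _ _) => // [u v _ _||].
- exact: subgraph_adjacent.
- by split=> // /(can_inj gK).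
- by split=> // /(can_inj gK).
Qed.

(** The family need not meet every branch at [z], so [n] is a lower bound for the
    number of branches there. *)
Definition branching (T : choiceType) (G : set (T -> T)) (n : nat) : Prop :=
  exists sep z t, [/\ separation sep, invariant_sep G sep, uniq t,
    separated_family sep z t & size t = n].

Theorem theorem3p3 (Omega : choiceType) (G : set (Omega -> Omega))
  (Omega_infinite : infinite_set [set: Omega])
  (G_primitive : primitive_group G)
  (G_ends : more_than_one_permutation_end G)
  (G_subdegrees : no_infinite_subdegree G) :
  exists D : digraph Omega,
    [/\ orbital_digraph G D, locally_finite D, has_connectivity D 1
      & forall H : digraph Omega, lobe D H -> at_most_one_end H].
Proof.
have [Ggrp Gtrans _] := G_primitive.
have [a0 _] := infinite_setN0 Omega_infinite.
have [b0 ab0] : exists b0, a0 <> b0.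
  apply: contrapT => no; apply: Omega_infinite; apply: sub_finite_set (finite_set1 a0).
  by move=> b _; apply: contrapT => nb; apply: no; exists b => /esym.
have [s0 Es0] := (finite_seqP _).1 (G_subdegrees a0 b0).
have gate sep : separation sep -> invariant_sep G sep -> exists D,
    [/\ orbital_digraph G D, forall u v z, adjacent D u v -> ~ sep z u v
     & forall z t, uniq t -> separated_family sep z t -> size t <= size s0].
  move=> S Sinv; have [D [oD nD bound]] :=
    gate_orbital Omega_infinite G_primitive S Sinv ab0.
  by exists D; split=> // z t ut St; apply: (bound z) => //; rewrite Es0.
have two : branching G 2.
  (* The set of all points but [a0] misses only one point, so it does not split
     [setT], and not all of its points lie in the same branch at [a0]. *)
  have [Gam oGam Gends] := G_ends.
  have GamT : vertices Gam = setT by case: oGam => [a [b []]].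
  have lfGam := orbital_locally_finite Ggrp G_subdegrees oGam.
  have [C [fC iC iC']] := ends_give_cut GamT lfGam (fun u p _ _ up => up) Gends.
  have cutC : exists C, splitting_cut (adjacent Gam) [set [set: Omega]] C.
    by exists C; split=> //; exists setT => //; rewrite -GamT.
  have inv g (B : set Omega) :
      G g -> [set [set: Omega]] B -> [set [set: Omega]] (g @^-1` B).
    by move=> _ ->.
  have [x _ sx] : exists2 x, (~` [set a0]) x &
      cut_sep (optimal_cut (adjacent Gam) [set setT]) a0 b0 x.
    apply: (optimal_separation_splits G_primitive oGam inv cutC).
    - exact: nesym.
    - by apply.
    - by move=> [_ -> [_]]; rewrite setCK setTI.
    - by move=> e _ _ nea u eu ua; apply: nea; rewrite -ua.
  exists (cut_sep (optimal_cut (adjacent Gam) [set setT])), a0, [:: b0; x].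
  have S := optimal_separation G_primitive oGam inv cutC.
  have [b0a xa0 b0x] := sep_neq S sx.
  split=> //.
  - exact: optimal_separation_invariant.
  - by rewrite /= inE andbT; apply/eqP.
  split=> [u|u v]; rewrite !inE.
    by move=> /orP[]/eqP->.
  by move=> /orP[]/eqP-> /orP[]/eqP-> // _; apply: sep_sym S _ _ _ sx.
have ex : exists n, `[< branching G n >] by exists 2; apply/asboolP.
have bounded n : `[< branching G n >] -> n <= size s0.
  move=> /asboolP[sep [z [t [S Sinv ut St <-]]]].
  by have [D [_ _ bound]] := gate sep S Sinv; exact: bound St.
case: (ex_maxnP ex bounded) => m /asboolP[sep [z [t [S Sinv ut St tm]]]] maxm.
have m2 : 1 < m by apply: maxm; apply/asboolP.
have [D [oD nD _]] := gate sep S Sinv.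
have DT : vertices D = setT by case: oD => [a [b []]].
have Dcon := orbital_connected G_primitive oD.
have lfD := orbital_locally_finite Ggrp G_subdegrees oD.
have [tz tsep] := St.
have apart u v : u \in t -> v \in t -> u <> v ->
    ~ reach (adjacent D) [set w | w <> z] u v.
  move=> ut' vt uv uv'; apply: (reach_not_sep S _ uv') (tsep u v ut' vt uv).
  by move=> x y; exact: nD.
have [b [b' [bt b't bb']]] : exists b b', [/\ b \in t, b' \in t & b <> b'].
  move: ut m2; rewrite -tm; case: (t) => [|b [|b' t']] //=.
  rewrite inE negb_or => /andP[/andP[/eqP bb' _] _] _.
  by exists b, b'; rewrite !inE !eqxx orbT.
exists D; split=> //.
  exact: (separated_connectivity1 Omega_infinite DT Dcon (tz b bt) (tz b' b't)
    (apart _ _ bt b't bb')).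
move=> H lH; apply: contrapT => nH.
have [C [fC iC iC']] := ends_give_cut DT lfD (lobe_path_closed DT lH) nH.
pose L : set (set Omega) := [set g @^-1` vertices H | g in G].
have [HD /lobe_candidateP[_ Hns] _] := lH.
have [_ Gid Gcomp _] := Ggrp.
have cutC : exists C, splitting_cut (adjacent D) L C.
  by exists C; split=> //; exists (vertices H) => //; exists id.
have inv g (B : set Omega) : G g -> L B -> L (g @^-1` B).
  by move=> Gg [k Gk <-]; exists (k \o g) => //; apply: Gcomp.
set sep' := cut_sep (optimal_cut (adjacent D) L).
have S' : separation sep' := optimal_separation G_primitive oD inv cutC.
have refines := optimal_separation_refines L G_primitive oD.
pose B := [set y | reach (adjacent D) [set u | u <> z] b y].
(* [x] lies in the same component as [b], hence in another one than the rest of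
   [t], and [sep'] refines the components; so [x] can be added to [t]. *)
have [x Bx sx] : exists2 x, B x & sep' z b x.
  apply: (optimal_separation_splits G_primitive oD inv cutC).
  - exact: tz.
  - by move=> Bz; case: (reach_target Bz).
  - exact: lobe_component_not_split.
  - move=> e con eb nez y ey; apply: reach_setS (con b y eb ey) => u eu uz.
    by apply: nez; rewrite -uz.
have [_ xz bx] := sep_neq S' sx.
have sxt u : u \in t -> x <> u /\ sep' z x u.
  move=> ut'; have [->|/eqP ub] := eqVneq u b.
    by split; [exact: nesym|exact: sep_sym].
  have nxu : ~ reach (adjacent D) [set w | w <> z] x u.
    by move=> xu; apply: (apart b u bt ut' (nesym ub)); apply: reach_trans xu.
  split; last by apply: refines => //; exact: tz.
  by move=> E; apply: nxu; rewrite -E; apply: reach_refl.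
suff : m.+1 <= m by rewrite ltnn.
apply: maxm; apply/asboolP; exists sep', z, (x :: t); split=> //.
- exact: optimal_separation_invariant.
- by rewrite /= ut andbT; apply/negP => /sxt[].
- split=> [u|u v]; rewrite !inE.
    by move=> /orP[/eqP->|/tz].
  move=> /orP[/eqP->|ut'] /orP[/eqP->|vt] // uv.
  + by have [] := sxt v vt.
  + by apply: sep_sym => //; have [] := sxt u ut'.
  + by apply: refines; [exact: tz|exact: tz|exact: apart].
- by rewrite /= tm.
Qed.
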